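(* Let $I=I_{(\mathfrak g_2,V)}$ be the $(\mathfrak g_2,V)$-invariant of framed 3-tangles, and put $q=e^{\hat h^2/(24h)}\in\mathbb C[[\hat h]]$. Consider the following 3-tangles with source and target the word $(\diamond\diamond)$ (blackboard framing, read from left to right): $X_+$ and $X_-$, the positive and negative crossing of two strands; $E$, two parallel horizontal strands (the identity); $U$, the composition of the cap (two left endpoints joined by an arc) followed by the cup (two right endpoints joined by an arc); and $H$, the composition of the vertex merging the two left endpoints into one horizontal edge followed by the vertex splitting this edge into two strands ending at the right endpoints. Then $$I(X_+)=\alpha\, I(X_-)+\beta\, I(E)+\gamma\, I(U)+\delta\, I(H)$$ as endomorphisms of $\mathbb C[[\hat h]]\otimes V\otimes V$, where $$\alpha=q,\qquad \beta=q-1,\qquad \gamma=\frac1{7c}\,(-q^7+q^{-6}-q+1),\qquad \delta=\frac1r\,(q^4-q^{-3}-q+1).$$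
   Context: **3-nets and 3-tangles.** A (framed) 3-net is a subset $N\subset\mathbb R^3$ with finitely many distinguished points $t_1,\dots,t_n\in N$ (trivalent vertices) such that each $t_i$ has a neighbourhood $U_i$ and a diffeomorphism $f_i$ from $U_i$ to the closed unit ball taking $N\cap U_i$ to the union of the three radii of the $xy$-plane at angles $0,2\pi/3,4\pi/3$, and such that $N\setminus\bigcup_i f_i^{-1}(\{|x|<\frac12\})$ is a smoothly embedded compact 1-manifold; $N$ carries a smooth vector field (framing) nowhere tangent to $N$. Boundary points of this 1-manifold outside all $U_i$ are univalent vertices. A 3-tangle is a 3-net in $[0,1]\times\mathbb R^2$ meeting $\{0,1\}\times\mathbb R^2$ exactly in its univalent vertices, which lie on $\{0\}\times\mathbb R\times\{0\}$ (source) or $\{1\}\times\mathbb R\times\{0\}$ (target), $N$ being perpendicular to these planes there with framing vector $(0,0,1)$. Equivalence is deformation within 3-tangles by a smooth 1-parameter family of diffeomorphisms of $\mathbb R^3$. Diagrams carry the blackboard framing and are read from left (source) to right (target). **Category $\mathcal T_{tpf}$.** The objects are non-associative (parenthesized) words in one letter $\diamond$, including the empty word; $l(w)$ is the number of letters of $w$. Morphisms are $\mathbb C$-linear combinations of equivalence classes of 3-tangles with parenthesized source and target. Composition $S_2\circ S_1$ is gluing $S_2$ to the right of $S_1$; $S_1\otimes S_2$ puts $S_1$ above $S_2$. Morphisms are generated by: reassociations $((vw)x)\to(v(wx))$ and inverses; crossings $(vw)\to(wv)$ of parallel strands, positive or negative (sign determined by orienting all strands from left to right); the cup (empty word $\to(\diamond\diamond)$)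 and the cap ($(\diamond\diamond)\to$ empty word); the splitting vertex $\diamond\to(\diamond\diamond)$ and the merging vertex $(\diamond\diamond)\to\diamond$. **Lie algebra data.** $\mathfrak g_2$ is the complex simple Lie algebra of type $G_2$, $V$ its 7-dimensional irreducible representation, $\kappa$ its Killing form, $h\in\mathbb C\setminus\{0\}$, $\hat h$ a formal parameter. One has $V\otimes V\cong\mathbb C\oplus V\oplus L\oplus W$ ($L$ adjoint, $W$ irreducible of highest weight twice that of $V$), with $\mathrm{Sym}^2V\cong\mathbb C\oplus W$, $\wedge^2V\cong V\oplus L$. Fix $\mathfrak g_2$-linear embeddings $i_{\mathbb C}:\mathbb C\to V\otimes V$, $i_V:V\to V\otimes V$ and let $p_{\mathbb C},p_V$ be the $\mathfrak g_2$-linear projections with $p_{\mathbb C}i_{\mathbb C}=\mathrm{id}$, $p_Vi_V=\mathrm{id}$. Define $m=(7p_{\mathbb C}\otimes\mathrm{id}_V)\circ(\mathrm{id}_V\otimes i_V):V\otimes V\to V$; then $m=k\,p_V$ with $k\in\mathbb C\setminus\{0\}$. Let $\Omega\in\mathfrak g_2\otimes\mathfrak g_2$ be the Casimir tensor of the form $h\kappa$. For words $v,w$ let $T_{v,w}=\hat h^2\Omega$ acting on $V^{\otimes l(v)}\otimes V^{\otimes l(w)}$. Let $\varphi(A,B)$ be the Knizhnik–Zamolodchikov associator: $G_0=G_1\,\varphi(A,B)$ for the solutions $G_0\sim x^{A/2\pi i}$ ($x\to0$) and $G_1\sim(1-x)^{B/2\pi i}$ ($x\to1$) of $G'(x)=\frac1{2\pi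 i}\left(\frac Ax+\frac B{x-1}\right)G(x)$. **The invariant.** $I=I_{(\mathfrak g_2,V)}$ (the composite of the universal Vassiliev–Kontsevich invariant extended to 3-tangles and the $(\mathfrak g_2,V)$-weight system) is the monoidal functor sending a word $w$ to $\mathbb C[[\hat h]]\otimes V^{\otimes l(w)}$, with values in $\mathbb C[[\hat h]]\otimes\mathrm{Hom}_{\mathfrak g_2}$, given by: the reassociation $((vw)x)\to(v(wx))$ goes to $\varphi(T_{v,w},T_{w,x})$ and its inverse to the inverse; the crossing of sign $\pm$ of $v,w$ goes to $\mathrm{flip}\circ\exp(\pm\frac12T_{v,w})$; cup $\mapsto\sqrt c\; i_{\mathbb C}$, cap $\mapsto\sqrt c\;7p_{\mathbb C}$; splitting vertex $\mapsto y\,i_V$, merging vertex $\mapsto x\,m$. Here, with $\Phi=\varphi(T_{\diamond,\diamond},T_{\diamond,\diamond})$ on $V^{\otimes3}$ (acting on factors 1,2 and 2,3), $c\in\mathbb C[[\hat h]]$ is defined by $(\mathrm{id}\otimes7p_{\mathbb C})\,\Phi\,(i_{\mathbb C}\otimes\mathrm{id})=c^{-1}\mathrm{id}_V$; $s\in\mathbb C[[\hat h]]$ by $(\mathrm{id}\otimes7p_{\mathbb C})\,\Phi\,(i_V\otimes\mathrm{id})=s\,m$ (both $c$ and $s$ have constant term 1, $\sqrt c$ is the root with constant term 1); and $x,y\in\mathbb C[[\hat h]]$ are invertible with $x=\sqrt c\,s\,y$. The remaining freedom is the choice of an invertible $r:=k\,x\,y\in\mathbb C[[\hat h]]$; thus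 merging after splitting has value $r\,\mathrm{id}_V$. With $q=e^{\hat h^2/(24h)}$ one has $7c=q^5+q^4+q+1+q^{-1}+q^{-4}+q^{-5}$. *)

(* Defs.v *)
From HB Require Import structures.
From mathcomp Require Import all_boot all_order all_algebra.
From mathcomp Require Import complex mxtens.
From mathcomp Require Import all_classical all_reals all_analysis.

Set Implicit Arguments.
Unset Strict Implicit.
Unset Printing Implicit Defensive.

Import Order.TTheory GRing.Theory Num.Theory.
Import numFieldNormedType.Exports.

Local Open Scope classical_set_scope.
Local Open Scope ring_scope.

(* K[[hh]]: a record rather than [nat -> K] itself, because functions already
   carry the pointwise ring structure. *)
Record fps (K : Type) := Fps { coefs : nat -> K }.
Add Printing Constructor fps.

HB.instance Definition _ (K : Type) := gen_eqMixin (fps K).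
HB.instance Definition _ (K : Type) := gen_choiceMixin (fps K).

Section FpsRing.
Variable K : fieldType.
Implicit Types f g e : fps K.

Lemma fpsP f g : coefs f =1 coefs g -> f = g.
Proof. by case: f g => [f] [g] /= /funext ->. Qed.

Definition fps_zero : fps K := Fps (fun=> 0).
Definition fps_opp f : fps K := Fps (fun n => - coefs f n).
Definition fps_add f g : fps K := Fps (fun n => coefs f n + coefs g n).
Definition fpsC (a : K) : fps K := Fps (fun n => a *+ (n == 0%N)).
Definition fpsX : fps K := Fps (fun n => (n == 1%N)%:R).
Definition fps_mul f g : fps K :=
  Fps (fun n => \sum_(i < n.+1) coefs f i * coefs g (n - i)).

Fact fps_addA : associative fps_add.
Proof. by move=> f g e; apply: fpsP => n /=; rewrite addrA. Qed.
Fact fps_addC : commutative fps_add.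
Proof. by move=> f g; apply: fpsP => n /=; rewrite addrC. Qed.
Fact fps_add0 : left_id fps_zero fps_add.
Proof. by move=> f; apply: fpsP => n /=; rewrite add0r. Qed.
Fact fps_addN : left_inverse fps_zero fps_opp fps_add.
Proof. by move=> f; apply: fpsP => n /=; rewrite addNr. Qed.

HB.instance Definition _ :=
  GRing.isZmodule.Build (fps K) fps_addA fps_addC fps_add0 fps_addN.

Definition fps_trunc m f : {poly K} := \poly_(i < m) coefs f i.

Lemma coef_fps_trunc m f i : (i < m)%N -> (fps_trunc m f)`_i = coefs f i.
Proof. by move=> im; rewrite coef_poly im. Qed.

Lemma fps_mul_trunc m f g n : (n < m)%N ->
  coefs (fps_mul f g) n = (fps_trunc m f * fps_trunc m g)`_n.
Proof.
move=> nm; rewrite coefM; apply: eq_bigr => i _.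
have im : (i < m)%N by exact: leq_ltn_trans (ltn_ord i : (i <= n)%N) nm.
by rewrite !coef_fps_trunc // (leq_ltn_trans (leq_subr _ _) nm).
Qed.

Fact fps_mulC : commutative fps_mul.
Proof.
by move=> f g; apply: fpsP => n; rewrite !(@fps_mul_trunc n.+1) // mulrC.
Qed.

Lemma fps_mul_truncl m f (p : {poly K}) n : (n < m)%N ->
  \sum_(i < n.+1) coefs f i * p`_(n - i) = (fps_trunc m f * p)`_n.
Proof.
move=> nm; rewrite coefM; apply: eq_bigr => i _.
by rewrite coef_fps_trunc // (leq_ltn_trans (ltn_ord i : (i <= n)%N) nm).
Qed.

Fact fps_mulA : associative fps_mul.
Proof.
have aux f g e n : coefs (fps_mul f (fps_mul g e)) n =
    (fps_trunc n.+1 f * (fps_trunc n.+1 g * fps_trunc n.+1 e))`_n.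
  rewrite -fps_mul_truncl //=; apply: eq_bigr => i _.
  by rewrite -fps_mul_trunc // ltnS leq_subr.
move=> f g e; apply: fpsP => n.
by rewrite (fps_mulC (fps_mul f g)) !aux mulrA [in RHS]mulrC.
Qed.

Fact fps_mul1 : left_id (fpsC 1) fps_mul.
Proof.
move=> f; apply: fpsP => n /=; rewrite big_ord_recl /= mul1r subn0.
by rewrite big1 ?addr0 // => i _; rewrite mul0r.
Qed.

Fact fps_mulDl : left_distributive fps_mul fps_add.
Proof.
move=> f g e; apply: fpsP => n /=; rewrite -big_split /=.
by apply: eq_bigr => i _; rewrite mulrDl.
Qed.

Fact fps_one_neq0 : fpsC 1 != 0.
Proof.
by apply/eqP => /(congr1 (fun f => coefs f 0%N)) /= /eqP; rewrite oner_eq0.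
Qed.

HB.instance Definition _ := GRing.Zmodule_isComNzRing.Build (fps K)
  fps_mulA fps_mulC fps_mul1 fps_mulDl fps_one_neq0.

(* [fps_inv_seq f n] is the sequence of the first n coefficients of f^-1 *)
Fixpoint fps_inv_seq f n : seq K :=
  if n is m.+1 then
    let s := fps_inv_seq f m in
    rcons s ((coefs f 0%N)^-1 *
             ((m == 0%N)%:R - \sum_(i < m) s`_i * coefs f (m - i)))
  else [::].

Definition fps_unit : {pred fps K} := fun f => coefs f 0%N != 0.
Definition fps_inv f : fps K :=
  if fps_unit f then Fps (fun n => (fps_inv_seq f n.+1)`_n) else f.

Lemma size_fps_inv_seq f n : size (fps_inv_seq f n) = n.
Proof. by elim: n => //= n IHn; rewrite size_rcons IHn. Qed.

Lemma nth_fps_inv_seq f n i : (i < n)%N ->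
  (fps_inv_seq f n)`_i = (fps_inv_seq f i.+1)`_i.
Proof.
elim: n => // n IHn; rewrite ltnS leq_eqVlt => /predU1P[-> //|lt_in].
by rewrite [in LHS]/= nth_rcons size_fps_inv_seq lt_in IHn.
Qed.

Fact fps_mulVf : {in fps_unit, left_inverse 1 fps_inv *%R}.
Proof.
move=> f f0; rewrite /fps_inv ifT //; apply: fpsP => n.
rewrite [LHS]/= big_ord_recr /= subnn nth_rcons size_fps_inv_seq ltnn eqxx.
rewrite mulrAC mulVf // mul1r addrC.
rewrite [X in _ + X](eq_bigr (fun i : 'I_n =>
    (fps_inv_seq f n)`_i * coefs f (n - i))); first by rewrite subrK.
by move=> i _; rewrite [in RHS]nth_fps_inv_seq.
Qed.

Fact fps_unitPl f g : g * f = 1 -> fps_unit f.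
Proof.
move=> /(congr1 (fun e => coefs e 0%N)) /=; rewrite big_ord1 /= => gf.
by apply/eqP => f0; move: gf => /eqP; rewrite f0 mulr0 eq_sym oner_eq0.
Qed.

Fact fps_inv_out : {in [predC fps_unit], fps_inv =1 id}.
Proof. by move=> f /negbTE f0; rewrite /fps_inv; move: f0; rewrite /in_mem /= => ->. Qed.

HB.instance Definition _ := GRing.ComNzRing_hasMulInverse.Build (fps K)
  fps_mulVf fps_unitPl fps_inv_out.

(* The exponential of a series, resp. of a square matrix of series, without
   constant term: the k-th power then only has terms of degree >= k, so the
   coefficient of hh^n of sum_k f^k / k! is a finite sum over k <= n. *)
Definition fps_exp f : fps K :=
  Fps (fun n => \sum_(k < n.+1) coefs (f ^+ k) n / k`!%:R).

Definition mx_exp N (A : 'M[fps K]_N) : 'M[fps K]_N :=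
  \matrix_(i, j) Fps (fun n => \sum_(k < n.+1) coefs ((A ^+ k) i j) n / k`!%:R).

End FpsRing.

Notation fpsM A := (map_mx (@fpsC _) A).

Section KZ.
Variable R : realType.
Local Notation C := R[i].
Variable N : nat.
Implicit Types (A B phi : 'M[fps C]_N) (G : R -> 'M[fps C]_N).

Definition real_cst (t : R) : C := real_complex R t.
Definition two_pi_i : C := real_cst (2 * pi) * 'i.

(* y^(A / 2 pi i) = exp (ln y * A / 2 pi i), for y > 0 *)
Definition kz_power (y : R) A : 'M[fps C]_N :=
  mx_exp (fpsC (real_cst (ln y) / two_pi_i) *: A).

Definition kz_rhs A B G (x : R) : 'M[fps C]_N :=
  fpsC two_pi_i^-1 *:
    ((fpsC (real_cst x)^-1 *: A + fpsC (real_cst (x - 1))^-1 *: B) *m G x).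

(* G' = 1/(2 pi i) (A/x + B/(x - 1)) G on ]0, 1[, for the coefficient of each
   power of hh in each entry *)
Definition kz_solution A B G : Prop :=
  forall x : R, 0 < x < 1 -> forall i j n,
    is_derive x 1 (fun t : R => complex.Re (coefs (G t i j) n) : R)
      (complex.Re (coefs (kz_rhs A B G x i j) n)) /\
    is_derive x 1 (fun t : R => complex.Im (coefs (G t i j) n) : R)
      (complex.Im (coefs (kz_rhs A B G x i j) n)).

Definition coef_cvg (F : set_system R) G (L : 'M[fps C]_N) : Prop :=
  forall i j n,
    (fun t : R => complex.Re (coefs (G t i j) n) : R) @ F -->
      complex.Re (coefs (L i j) n) /\
    (fun t : R => complex.Im (coefs (G t i j) n) : R) @ F -->
      complex.Im (coefs (L i j) n).

(* "G0 ~ x^(A/2 pi i)" means G0(x) x^(-A/2 pi i) --> 1, and similarly at 1.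
   Each normalized solution is unique, because y^A M y^(-A) has polynomial
   coefficients in ln y, and so tends to 1 only if M = 1. *)
Definition is_kz_associator A B phi : Prop :=
  exists G0 G1 : R -> 'M[fps C]_N,
    [/\ kz_solution A B G0, kz_solution A B G1,
        coef_cvg 0^'+ (fun x => G0 x *m kz_power x (- A)) 1%:M,
        coef_cvg 1^'- (fun x => G1 x *m kz_power (1 - x) (- B)) 1%:M &
        forall x : R, 0 < x < 1 -> G0 x = G1 x *m phi].

(* The associator exists and is unique when A and B have no constant term;
   the default value of [xget] is irrelevant. *)
Definition kz_associator A B : 'M[fps C]_N :=
  xget 1%:M [set phi | is_kz_associator A B phi].

End KZ.

Section LieAlgebra.
Variables (K : fieldType) (g : vectType K) (br : g -> g -> g).

Definition is_lie_bracket : Prop :=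
  [/\ forall a x y z, br (a *: x + y) z = a *: br x z + br y z,
      forall a x y z, br x (a *: y + z) = a *: br x y + br x z,
      forall x, br x x = 0 &
      forall x y z, br x (br y z) + br y (br z x) + br z (br x y) = 0].

Definition is_ideal (U : {vspace g}) : Prop :=
  forall x u, u \in U -> br x u \in U.

Definition lie_simple : Prop :=
  (exists x y, br x y != 0) /\
  (forall U : {vspace g}, is_ideal U -> U = 0%VS \/ U = fullv).

Definition is_lie_subalgebra (U : {vspace g}) : Prop :=
  forall x y, x \in U -> y \in U -> br x y \in U.

Definition cartan_G2 (i j : 'I_2) : int :=
  if i == j then 2 else if i == 0 then -1 else -3.

(* Generation by Chevalley generators subject to the Chevalley-Serre relations
   of the Cartan matrix of type G2 *)
Definition lie_type_G2 : Prop :=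
  exists e f hc : 'I_2 -> g,
    [/\ forall i j, br (hc i) (hc j) = 0,
        forall i j, br (e i) (f j) = (if i == j then hc i else 0),
        forall i j, br (hc i) (e j) = e j *~ cartan_G2 i j /\
                    br (hc i) (f j) = - (f j *~ cartan_G2 i j),
        forall i j, i != j ->
          iter `|1 - cartan_G2 i j|%N (br (e i)) (e j) = 0 /\
          iter `|1 - cartan_G2 i j|%N (br (f i)) (f j) = 0 &
        forall U : {vspace g}, is_lie_subalgebra U ->
          (forall i, [&& e i \in U, f i \in U & hc i \in U]) -> U = fullv].

(* kappa(x, y) = tr (ad x o ad y) *)
Definition killing (x y : g) : K :=
  let b := vbasis {:g} in
  \sum_(i < \dim {:g}) coord b i (br x (br y b`_i)).

Variables (d : nat) (rho : g -> 'M[K]_d).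

Definition is_lie_rep : Prop :=
  linear rho /\
  (forall x y, rho (br x y) = rho x *m rho y - rho y *m rho x).

(* matrices act on column vectors *)
Definition lie_irreducible : Prop :=
  (0 < d)%N /\
  (forall U : {vspace 'cV[K]_d},
    (forall x u, u \in U -> rho x *m u \in U) -> U = 0%VS \/ U = fullv).

End LieAlgebra.

(* [mor K a b] is the space of K-linear maps V^{(x) a} -> V^{(x) b}, as matrices
   acting on columns in the bases of pure tensors in lexicographic order (so
   that tensor products of maps are Kronecker products). *)
Definition mor (K : Type) (a b : nat) : Type := 'M[K]_(7 ^ b, 7 ^ a).

Definition cast_mor (K : Type) (a a' b b' : nat) (ea : a = a') (eb : b = b')
    (f : mor K a b) : mor K a' b' :=
  castmx (congr1 (expn 7) eb, congr1 (expn 7) ea) f.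

Section Tensor.
Variable K : comNzRingType.

Definition mor_id (a : nat) : mor K a a := 1%:M.

Definition mor_comp (a b c : nat) (f : mor K b c) (f' : mor K a b) : mor K a c :=
  f *m f'.

Definition mor_tens (a b a' b' : nat) (f : mor K a b) (f' : mor K a' b') :
    mor K (a + a') (b + b') :=
  castmx (esym (expnD 7 b b'), esym (expnD 7 a a')) (f *t f').

(* u (x) u' |-> u' (x) u *)
Definition mor_flip (a b : nat) : mor K (a + b) (b + a) :=
  castmx (esym (expnD 7 b a), esym (expnD 7 a b))
    (\matrix_(i < 7 ^ b * 7 ^ a, j < 7 ^ a * 7 ^ b)
       [&& (mxtens_unindex i).1 == (mxtens_unindex j).2
         & (mxtens_unindex i).2 == (mxtens_unindex j).1]%:R).

End Tensor.

Arguments mor_id {K} a.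
Arguments mor_flip {K} a b.

Section TensorRep.
Variables (K : fieldType) (g : vectType K) (br : g -> g -> g).
Variable rho : g -> 'M[K]_7.

Fixpoint rho_tens (n : nat) (x : g) : mor K n n :=
  if n is m.+1 then
    mor_tens (rho x : mor K 1 1) (mor_id m) + mor_tens (mor_id 1) (rho_tens m x)
  else 0.

Definition is_equivariant (a b : nat) (f : mor K a b) : Prop :=
  forall x, mor_comp (rho_tens b x) f = mor_comp f (rho_tens a x).

(* The Casimir tensor of the form h kappa, namely sum_ij (M^-1)_ij b_i (x) b_j
   for a basis b of g with Gram matrix M, acting on V^{(x) a} (x) V^{(x) b} *)
Definition casimir (h : K) (a b : nat) : mor K (a + b) (a + b) :=
  let bs := vbasis {:g} in
  let gram : 'M[K]_(\dim {:g}) := \matrix_(i, j) (h * killing br bs`_i bs`_j) in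
  \sum_i \sum_j invmx gram i j *: mor_tens (rho_tens a bs`_i) (rho_tens b bs`_j).

End TensorRep.

Inductive tree : Type := Letter | Node of tree & tree.

(* [None] is the empty word, a strict unit for concatenation *)
Definition word : Type := option tree.

Definition wempty : word := None.
Definition wdiam : word := Some Letter.
Definition wprod (v w : word) : word :=
  match v, w with
  | None, _ => w
  | _, None => v
  | Some s, Some t => Some (Node s t)
  end.

Fixpoint leaves (t : tree) : nat :=
  if t is Node t1 t2 then (leaves t1 + leaves t2)%N else 1%N.
Definition wlen (w : word) : nat := if w is Some t then leaves t else 0%N.

Lemma wlen_prod v w : (wlen v + wlen w = wlen (wprod v w))%N.
Proof. by case: v w => [s|] [t|] //=; rewrite addn0. Qed.

Lemma wlen_prodl u v w :
  (wlen u + wlen v + wlen w = wlen (wprod (wprod u v) w))%N.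
Proof. by rewrite -!wlen_prod. Qed.

Lemma wlen_prodr u v w :
  (wlen u + wlen v + wlen w = wlen (wprod u (wprod v w)))%N.
Proof. by rewrite -!wlen_prod addnA. Qed.

(* [tangle v w]: 3-tangles with source v and target w, as composites and tensor
   products of the generators of T_tpf. [Comp S2 S1] glues S2 to the right of
   S1, and [Tens S1 S2] puts S1 above S2. Isotopic composites are not
   identified: an identity between values of [tangle_inv] on given composites
   is an identity between its values on their isotopy classes. *)
Inductive tangle : word -> word -> Type :=
| Id w : tangle w w
| Comp u v w : tangle v w -> tangle u v -> tangle u w
| Tens v1 w1 v2 w2 :
    tangle v1 w1 -> tangle v2 w2 -> tangle (wprod v1 v2) (wprod w1 w2)
| Assoc u v w : tangle (wprod (wprod u v) w) (wprod u (wprod v w))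
| AssocInv u v w : tangle (wprod u (wprod v w)) (wprod (wprod u v) w)
| CrossPos v w : tangle (wprod v w) (wprod w v)
| CrossNeg v w : tangle (wprod v w) (wprod w v)
| Cup : tangle wempty (wprod wdiam wdiam)
| Cap : tangle (wprod wdiam wdiam) wempty
| Split : tangle wdiam (wprod wdiam wdiam)
| Merge : tangle (wprod wdiam wdiam) wdiam.

Definition tangle_Xpos : tangle (wprod wdiam wdiam) (wprod wdiam wdiam) :=
  CrossPos wdiam wdiam.
Definition tangle_Xneg : tangle (wprod wdiam wdiam) (wprod wdiam wdiam) :=
  CrossNeg wdiam wdiam.
Definition tangle_E : tangle (wprod wdiam wdiam) (wprod wdiam wdiam) :=
  Id (wprod wdiam wdiam).
Definition tangle_U : tangle (wprod wdiam wdiam) (wprod wdiam wdiam) :=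
  Comp Cup Cap.
Definition tangle_H : tangle (wprod wdiam wdiam) (wprod wdiam wdiam) :=
  Comp Split Merge.

(* The choices i_C, i_V, p_C, p_V and the scalars k, c, sqrt c, s, x, y that
   enter the values of the invariant on the generators *)
Record inv_data (R : realType) := InvData {
  embC : mor R[i] 0 2;
  embV : mor R[i] 1 2;
  projC : mor R[i] 2 0;
  projV : mor R[i] 2 1;
  kfac : R[i];
  cser : fps R[i];
  sqrtc : fps R[i];
  sser : fps R[i];
  xser : fps R[i];
  yser : fps R[i] }.

Section Invariant.
Variable R : realType.
Local Notation C := R[i].
Local Notation Ch := (fps R[i]).
Variables (g : vectType C) (br : g -> g -> g) (rho : g -> 'M[C]_7) (h : C).

Definition T_op (a b : nat) : mor Ch (a + b) (a + b) :=
  (fpsX C) ^+ 2 *: fpsM (casimir br rho h a b).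

Definition Phi_op (a b c : nat) : mor Ch (a + b + c) (a + b + c) :=
  kz_associator
    (mor_tens (T_op a b) (mor_id c))
    (cast_mor (addnA a b c) (addnA a b c) (mor_tens (mor_id a) (T_op b c))).

Definition mult (D : inv_data R) : mor C 2 1 :=
  mor_comp (mor_tens (7%:R *: projC D : mor C 2 0) (mor_id 1) : mor C 3 1)
           (mor_tens (mor_id 1) (embV D) : mor C 2 3).

Definition is_inv_data (D : inv_data R) : Prop :=
  [/\ [/\ is_equivariant rho (embC D), is_equivariant rho (embV D),
          is_equivariant rho (projC D) & is_equivariant rho (projV D)],
      mor_comp (projC D) (embC D) = mor_id 0 /\
      mor_comp (projV D) (embV D) = mor_id 1,
      mult D = kfac D *: projV D /\ kfac D != 0,
      [/\ mor_comp (mor_tens (mor_id 1) (fpsM (7%:R *: projC D) : mor Ch 2 0)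
                      : mor Ch 3 1)
            (mor_comp (Phi_op 1 1 1)
               (mor_tens (fpsM (embC D) : mor Ch 0 2) (mor_id 1) : mor Ch 1 3))
            = (cser D)^-1 *: mor_id 1,
          cser D \is a GRing.unit,
          sqrtc D ^+ 2 = cser D &
          coefs (sqrtc D) 0 = 1] &
      [/\ mor_comp (mor_tens (mor_id 1) (fpsM (7%:R *: projC D) : mor Ch 2 0)
                      : mor Ch 3 1)
            (mor_comp (Phi_op 1 1 1)
               (mor_tens (fpsM (embV D) : mor Ch 1 2) (mor_id 1) : mor Ch 2 3))
            = sser D *: (fpsM (mult D) : mor Ch 2 1),
          xser D \is a GRing.unit,
          yser D \is a GRing.unit &
          xser D = sqrtc D * sser D * yser D]].

Definition rser (D : inv_data R) : Ch := fpsC (kfac D) * xser D * yser D.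

Definition qser : Ch := fps_exp (fpsC (24%:R * h)^-1 * fpsX C ^+ 2).

Fixpoint tangle_inv (D : inv_data R) (v w : word) (S : tangle v w) :
    mor Ch (wlen v) (wlen w) :=
  match S in tangle v w return mor Ch (wlen v) (wlen w) with
  | Id w => mor_id (wlen w)
  | Comp _ _ _ S2 S1 => mor_comp (tangle_inv D S2) (tangle_inv D S1)
  | Tens v1 w1 v2 w2 S1 S2 =>
      cast_mor (wlen_prod v1 v2) (wlen_prod w1 w2)
        (mor_tens (tangle_inv D S1) (tangle_inv D S2))
  | Assoc u v w =>
      cast_mor (wlen_prodl u v w) (wlen_prodr u v w)
        (Phi_op (wlen u) (wlen v) (wlen w))
  | AssocInv u v w =>
      cast_mor (wlen_prodr u v w) (wlen_prodl u v w)
        (invmx (Phi_op (wlen u) (wlen v) (wlen w)))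
  | CrossPos v w =>
      cast_mor (wlen_prod v w) (wlen_prod w v)
        (mor_comp (mor_flip (wlen v) (wlen w))
           (mx_exp (fpsC 2%:R^-1 *: T_op (wlen v) (wlen w))))
  | CrossNeg v w =>
      cast_mor (wlen_prod v w) (wlen_prod w v)
        (mor_comp (mor_flip (wlen v) (wlen w))
           (mx_exp (- (fpsC 2%:R^-1 *: T_op (wlen v) (wlen w)))))
  | Cup => sqrtc D *: fpsM (embC D)
  | Cap => sqrtc D *: fpsM (7%:R *: projC D)
  | Split => yser D *: fpsM (embV D)
  | Merge => xser D *: fpsM (mult D)
  end.

End Invariant.

Arguments tangle_inv {R g} br rho h D {v w} S.

(* Main.v *)
Require Import Defs.
From HB Require Import structures.
From mathcomp Require Import all_boot all_order all_algebra.
From mathcomp Require Import complex mxtens.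
From mathcomp Require Import all_classical all_reals all_analysis.
From mathcomp Require Import ring zify.
Import Order.TTheory GRing.Theory Num.Theory.
Import numFieldNormedType.Exports.
Local Open Scope ring_scope.

(** Write [PC] and [PV] for the projections of [V (x) V] on its trivial and
    7-dimensional submodules.  Everything follows from the formula
      [24 h Omega = 1 + flip - 14 PC - 6 PV]
    on [V (x) V]: it makes [flip exp (+- hh^2 Omega / 2)] explicit combinations
    of four idempotents, with eigenvalues [q^(-6)], [- q^(-3)], [- 1], [q] for
    the sign [+], and the relation is checked on each of them.

    To prove the formula, one puts the representation in a standard form.  The
    [sl2]-strings through a highest weight vector of weight [(a, b)] contain at
    least 8 distinct weights unless [(a, b)] is [(0, 0)] or the fundamental
    weight [(0, 1)], so in dimension 7 the Chevalley generators act by explicit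
    integer matrices.  Iterated brackets of the generators then give a basis of
    the Lie algebra with integral structure constants, from which the Killing
    form and the Casimir tensor are computed.  The embeddings and projections of
    the statement are identified up to scalars by Schur's lemma and by the
    uniqueness of the highest weight vector of weight [(0, 1)] in [V (x) V]. *)

Set Implicit Arguments.
Unset Strict Implicit.

(** * Weight vectors and sl2-strings *)

(** Each scalar is a root of the characteristic polynomial, which has degree [d]. The transpose is
    taken because [eigenvalue] refers to row vectors. *)
Lemma distinct_eigenvalues (K : fieldType) (d : nat) (H : 'M[K]_d) (s : seq K) :
  uniq s -> (forall c, c \in s -> exists2 u : 'cV_d, u != 0 & H *m u = c *: u) ->
  (size s <= d)%N.
Proof.
move=> s_uniq s_eig; rewrite -ltnS -(size_char_poly H^T).
apply: max_poly_roots => //; first by rewrite monic_neq0 // char_poly_monic.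
apply/allP => c /s_eig[u u0 Hu]; rewrite -eigenvalue_root_char.
apply/eigenvalueP; exists u^T; first by rewrite -trmx_mul Hu linearZ.
by rewrite trmx_eq0.
Qed.

Section Weights.
Variables (K : numFieldType) (d : nat).
Implicit Types (e f h x y : 'M[K]_d) (u : 'cV[K]_d).

Lemma eigen_shift h x (a c : K) u : h *m x = x *m h + a *: x ->
  h *m u = c *: u -> h *m (x *m u) = (c + a) *: (x *m u).
Proof.
move=> hx hu; rewrite mulmxA hx mulmxDl -mulmxA hu -scalemxAl -scalemxAr.
by rewrite -scalerDl.
Qed.

Lemma eigen_shift_iter h x (a c : K) u k : h *m x = x *m h + a *: x ->
  h *m u = c *: u ->
  h *m iter k (mulmx x) u = (c + a *+ k) *: iter k (mulmx x) u.
Proof.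
move=> hx hu; elim: k => [|k IHk] /=; first by rewrite mulr0n addr0.
by rewrite (eigen_shift hx IHk) mulrS (addrC a) addrA.
Qed.

Lemma comm_iter x y u k : x *m y = y *m x ->
  x *m iter k (mulmx y) u = iter k (mulmx y) (x *m u).
Proof. by move=> xy; elim: k => //= k <-; rewrite !mulmxA xy. Qed.

Lemma iter_mulmx0 x k : iter k (mulmx x) (0 : 'cV[K]_d) = 0.
Proof. by elim: k => //= k ->; rewrite mulmx0. Qed.

Section Sl2.
Variables e f h : 'M[K]_d.
Hypothesis ef : e *m f = f *m e + h.
Hypothesis hf : h *m f = f *m h + (- 2%:R) *: f.

(** Moving [e] to the right past the factors [f] adds up the weights [n, n - 2, ..., n - 2k], whose
    sum is [(k + 1)(n - k)]. *)
Lemma sl2_raise n u k : e *m u = 0 -> h *m u = n *: u ->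
  e *m iter k.+1 (mulmx f) u =
  (k.+1%:R * (n - k%:R)) *: iter k (mulmx f) u.
Proof.
move=> eu hu; elim: k => [|k IHk] /=.
  by rewrite mulmxA ef mulmxDl -mulmxA eu mulmx0 add0r hu subr0 mul1r.
rewrite mulmxA ef mulmxDl -mulmxA [e *m _]IHk -scalemxAr.
rewrite -[f *m iter k _ _]/(iter k.+1 (mulmx f) u).
rewrite (eigen_shift_iter k.+1 hf hu) -scalerDl; congr (_ *: _).
rewrite -!natr1 -mulr_natr; ring.
Qed.

Lemma sl2_iter_neq0 (n : nat) u k : u != 0 -> e *m u = 0 ->
  h *m u = n%:R *: u -> (k <= n)%N -> iter k (mulmx f) u != 0.
Proof.
move=> u0 eu hu; elim: k => // k IHk kn; apply/eqP => fk0.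
have := sl2_raise k eu hu; rewrite fk0 mulmx0 => /esym/eqP.
rewrite scaler_eq0 mulf_eq0 pnatr_eq0 subr_eq0 eqr_nat (gtn_eqF kn) /=.
by rewrite (negbTE (IHk (ltnW kn))).
Qed.

(** The nonzero vectors of the string have distinct weights [n - 2k], so the string stops. At its
    last nonzero vector the factor [n - m] of [sl2_raise] must vanish. *)
Lemma sl2_weight_nat (n : K) u : u != 0 -> e *m u = 0 -> h *m u = n *: u ->
  exists2 m : nat, n = m%:R & iter m.+1 (mulmx f) u = 0.
Proof.
move=> u0 eu hu.
have [k /eqP fk0] : exists k, iter k (mulmx f) u == 0.
  case: (boolP [exists k : 'I_d.+1, iter k (mulmx f) u == 0]).
    by case/existsP => k fk0; exists k.
  rewrite negb_exists => /forallP fk_neq0.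
  suff: (size [seq (n - 2%:R *+ k)%R | k <- iota 0 d.+1] <= d)%N.
    by rewrite size_map size_iota ltnn.
  apply: (@distinct_eigenvalues _ _ h).
    rewrite map_inj_uniq ?iota_uniq // => i j /addrI/oppr_inj/eqP.
    by rewrite -!mulrnA eqr_nat eqn_pmul2l // => /eqP.
  move=> c /mapP[k]; rewrite mem_iota add0n => /andP[_ kd] ->.
  exists (iter k (mulmx f) u); first exact: fk_neq0 (Ordinal kd).
  by rewrite (eigen_shift_iter k hf hu) mulNrn.
have exk : exists k, iter k (mulmx f) u == 0 by exists k; apply/eqP.
case: (ex_minnP exk) => -[|m] /eqP fm0 m_min.
  by move: fm0 u0 => /= ->; rewrite eqxx.
exists m => //; have := sl2_raise m eu hu; rewrite fm0 mulmx0 => /esym/eqP.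
rewrite scaler_eq0 mulf_eq0 pnatr_eq0 /= => /orP[|/m_min]; last by rewrite ltnn.
by rewrite subr_eq0 => /eqP.
Qed.

Lemma sl2_iter_eq0 (n : nat) u : e *m u = 0 -> h *m u = n%:R *: u ->
  iter n.+1 (mulmx f) u = 0.
Proof.
move=> eu hu; have [->|u0] := eqVneq u 0; first exact: iter_mulmx0.
by have [m /eqP] := sl2_weight_nat u0 eu hu; rewrite eqr_nat => /eqP ->.
Qed.

End Sl2.
End Weights.

(** * Integer tables for the standard representation *)

Section IntMatrices.
Implicit Types l : seq (seq int).

Definition entry l (i j : nat) : int := nth 0 (nth [::] l i) j.
Definition tabulate (n : nat) (f : nat -> nat -> int) := mkseq (fun i => mkseq (f i) n) n.
(** A sum that [vm_compute] can evaluate, the big operators being locked. *)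
Definition isum (n : nat) (f : nat -> int) : int := foldr +%R 0 (mkseq f n).
Definition commutator l l' := tabulate 7 (fun i j =>
  isum 7 (fun k => entry l i k * entry l' k j - entry l' i k * entry l k j)).

Lemma entry_tabulate n f i j : (i < n)%N -> (j < n)%N -> entry (tabulate n f) i j = f i j.
Proof. by move=> lt_in lt_jn; rewrite /entry /tabulate nth_mkseq ?nth_mkseq. Qed.

Lemma isumE n f : isum n f = \sum_(i < n) f i.
Proof. by rewrite /isum -(big_mkord xpredT) unlock foldr_map /index_iota subn0. Qed.

Definition mx7 (C : pzRingType) l : 'M[C]_7 := \matrix_(i, j) (entry l i j)%:~R.

Lemma mx7_commutator (C : pzRingType) l l' :
  mx7 C (commutator l l') = mx7 C l *m mx7 C l' - mx7 C l' *m mx7 C l.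
Proof.
apply/matrixP => i j; rewrite !mxE entry_tabulate // isumE rmorph_sum -sumrB.
by apply: eq_bigr => k _; rewrite !mxE rmorphB !rmorphM.
Qed.

End IntMatrices.

(* The triples are (row, column, coefficient). *)
Definition sparse (s : seq (nat * nat * nat)) := tabulate 7 (fun i j =>
  foldr (fun p acc => (if (p.1.1 == i) && (p.1.2 == j) then Posz p.2 else 0) + acc) 0 s).

(** Column [j] is the image of [vj] in the basis [v0], [v1 = f1 v0], [v2 = f0 v1], [v3 = f1 v2],
    [v4 = f1 v3], [v5 = f0 v4], [v6 = f1 v5], where [v0] is a highest weight vector of weight
    [(0, 1)]. *)
Definition tabE0 := Eval vm_compute in sparse [:: (1, 2, 1); (4, 5, 1)]%N.
Definition tabE1 := Eval vm_compute in
  sparse [:: (0, 1, 1); (2, 3, 2); (3, 4, 2); (5, 6, 1)]%N.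
Definition tabF0 := Eval vm_compute in sparse [:: (2, 1, 1); (5, 4, 1)]%N.
Definition tabF1 := Eval vm_compute in
  sparse [:: (1, 0, 1); (3, 2, 1); (4, 3, 1); (6, 5, 1)]%N.
Definition tabH0 := Eval vm_compute in commutator tabE0 tabF0.
Definition tabH1 := Eval vm_compute in commutator tabE1 tabF1.

(** The brackets run through the roots [alpha0], [alpha1], [alpha0 + alpha1], [alpha0 + 2 alpha1],
    [alpha0 + 3 alpha1], [2 alpha0 + 3 alpha1], with [alpha1] short, or through their negatives. The
    type is arbitrary so that the same brackets can be formed on tables and in the Lie algebra. *)
Definition root_vectors (T : Type) (br : T -> T -> T) (x0 x1 : T) : seq T :=
  let x2 := br x1 x0 in let x3 := br x1 x2 in let x4 := br x1 x3 in
  [:: x0; x1; x2; x3; x4; br x0 x4].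
Definition lie_basis (T : Type) (br : T -> T -> T) (e0 e1 f0 f1 h0 h1 : T) : seq T :=
  root_vectors br e0 e1 ++ root_vectors br f0 f1 ++ [:: h0; h1].

Definition G2_tabs : seq (seq (seq int)) :=
  Eval vm_compute in lie_basis commutator tabE0 tabE1 tabF0 tabF1 tabH0 tabH1.
Definition basis_tab a := nth [::] G2_tabs a.

(* Each root vector has a nonzero entry at a position where all the other
   vectors of the basis vanish; these 12 positions are listed in order. *)
Definition coords (l : seq (seq int)) : seq int :=
  mkseq (fun k => let: (i, j) := nth (0, 0)%N
    [:: (1, 2); (0, 1); (0, 2); (0, 3); (0, 4); (0, 5);
        (2, 1); (1, 0); (2, 0); (3, 0); (4, 0); (5, 0)]%N k in
    (entry l i j %/ entry (basis_tab k) i j)%Z) 12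
  ++ [:: entry l 0 0 + entry l 1 1; entry l 0 0].

Definition structure_table : seq (seq (seq int)) := Eval vm_compute in
  mkseq (fun a => mkseq (fun b => coords (commutator (basis_tab a) (basis_tab b))) 14) 14.
Definition lie_struct a b k := nth 0 (nth [::] (nth [::] structure_table a) b) k.
Definition killing_table : seq (seq int) := Eval vm_compute in
  tabulate 14 (fun a b =>
    isum 14 (fun k => isum 14 (fun l => lie_struct a k l * lie_struct b l k))).

(* 288 times the inverse of [killing_table] *)
Definition dual_table : seq (seq int) := tabulate 14 (fun a b : nat =>
  if (12 <= minn a b)%N then nth 0 [:: 72; 36; 24] (a + b - 24)%N
  else if (a < 12)%N && (b == (a + 6) %% 12)%N
  then nth 0 [:: 36; 12; - 12; 3; - 1; 1] (a %% 6)%N else 0).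

(** The invariant symmetric form pairs opposite weights. Being its own inverse, the matrix is also
    the invariant tensor in [V (x) V]. *)
Definition form_tab := Eval vm_compute in tabulate 7 (fun i j =>
  if (i + j == 6)%N then (- 1) ^+ i else 0).

(* the action on [V (x) V], for tensors written as matrices *)
Definition derive2 l l' := tabulate 7 (fun i k =>
  isum 7 (fun j => entry l i j * entry l' j k + entry l' i j * entry l k j)).

(* The m-th matrix is the image of the m-th basis vector under the embedding of
   [V] in [V (x) V] that sends the highest weight vector to [z0]. *)
Definition cross_tabs : seq (seq (seq int)) := Eval vm_compute in
  let z0 := tabulate 7 (fun i k => if (i + k == 3)%N
    then nth 0 [:: - 1; 2; - 2; 1] i else 0) in
  let z1 := derive2 tabF1 z0 in let z2 := derive2 tabF0 z1 in
  let z3 := derive2 tabF1 z2 in let z4 := derive2 tabF1 z3 in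
  let z5 := derive2 tabF0 z4 in [:: z0; z1; z2; z3; z4; z5; derive2 tabF1 z5].
Definition cross_tab m := nth [::] cross_tabs m.
(* the transpose of the dual embedding, the duals of [V] and [V (x) V] being
   identified with themselves by the invariant form *)
Definition cocross_tabs := Eval vm_compute in mkseq (fun m => tabulate 7 (fun i k =>
  isum 7 (fun l => isum 7 (fun j => entry form_tab i j *
    isum 7 (fun n => entry form_tab n m * entry (cross_tab n) j l)) * entry form_tab l k))) 7.
Definition cocross_tab m := nth [::] cocross_tabs m.

Lemma all_iota0 n (P : pred nat) : all P (iota 0 n) -> forall i : 'I_n, P i.
Proof. by move/allP => allP i; apply: allP; rewrite mem_iota /=. Qed.

(** * Identities between the integer tables, over a commutative ring *)

Section Casted.
Variable C : comPzRingType.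
Local Notation mx7 := (mx7 C).

(** Here and in the rest of the section the identity is decided on integer entries by [vm_compute],
    then carried over by the morphism from [int]. *)
Lemma basis_tab_commutator (a b : 'I_14) :
  mx7 (basis_tab a) *m mx7 (basis_tab b) - mx7 (basis_tab b) *m mx7 (basis_tab a) =
  \sum_(k < 14) (lie_struct a b k)%:~R *: mx7 (basis_tab k).
Proof.
have : all (fun a => all (fun b => commutator (basis_tab a) (basis_tab b) ==
    tabulate 7 (fun i j =>
      isum 14 (fun k => lie_struct a b k * entry (basis_tab k) i j)))
  (iota 0 14)) (iota 0 14) by vm_compute.
move=> /all_iota0/(_ a)/all_iota0/(_ b)/eqP ab.
rewrite -mx7_commutator ab; apply/matrixP => i j.
rewrite !mxE entry_tabulate // isumE rmorph_sum summxE.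
by apply: eq_bigr => k _; rewrite !mxE rmorphM.
Qed.

Lemma killing_tableE (a b : 'I_14) :
  (entry killing_table a b)%:~R =
  \sum_(k < 14) \sum_(l < 14)
    (lie_struct a k l)%:~R * (lie_struct b l k)%:~R :> C.
Proof.
have : all (fun a => all (fun b => entry killing_table a b ==
    isum 14 (fun k => isum 14 (fun l =>
      lie_struct a k l * lie_struct b l k)))
  (iota 0 14)) (iota 0 14) by vm_compute.
move=> /all_iota0/(_ a)/all_iota0/(_ b)/eqP ->.
rewrite isumE rmorph_sum; apply: eq_bigr => k _.
by rewrite isumE rmorph_sum; apply: eq_bigr => l _; rewrite rmorphM.
Qed.

(** Used for the linear independence of the 14 basis vectors: a relation among the matrices is
    orthogonal to all of them for the trace form, hence lies in the radical of the Killing form. *)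
Lemma mxtrace_basis_tab (a b : 'I_14) :
  4%:R * \tr (mx7 (basis_tab a) *m mx7 (basis_tab b)) = (entry killing_table a b)%:~R.
Proof.
have : all (fun a => all (fun b => entry killing_table a b ==
    4%:R * isum 7 (fun i => isum 7 (fun j =>
      entry (basis_tab a) i j * entry (basis_tab b) j i)))
  (iota 0 14)) (iota 0 14) by vm_compute.
move=> /all_iota0/(_ a)/all_iota0/(_ b)/eqP ->.
rewrite rmorphM rmorph_nat isumE rmorph_sum; congr (_ * _); apply: eq_bigr => i _.
by rewrite mxE isumE rmorph_sum; apply: eq_bigr => j _; rewrite !mxE rmorphM.
Qed.

Lemma killing_dual (a b : 'I_14) :
  \sum_(k < 14) (entry killing_table a k)%:~R * (entry dual_table k b)%:~R =
  (a == b)%:R * 288%:R :> C.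
Proof.
have : all (fun a => all (fun b => isum 14 (fun k =>
    entry killing_table a k * entry dual_table k b) == (a == b)%:R * 288%:R)
  (iota 0 14)) (iota 0 14) by vm_compute.
move=> /all_iota0/(_ a)/all_iota0/(_ b)/eqP/(congr1 (intr : int -> C)).
rewrite isumE rmorph_sum rmorphM !rmorph_nat => <-.
by apply: eq_bigr => k _; rewrite rmorphM.
Qed.

(** Entrywise, this is [12] times the formula for [24 h Omega]: the form tensor contributes [7 PC]
    and the cross tensors [6 PV], whence the coefficients [24 = 12 * 14 / 7] and
    [12 = 12 * 6 / 6]. *)
Lemma casimir_entries (i j k l : 'I_7) :
  \sum_(a < 14) \sum_(b < 14) (entry dual_table a b)%:~R *
    (mx7 (basis_tab a) i j * mx7 (basis_tab b) k l) =
  12%:R * ((i == j) && (k == l))%:R + 12%:R * ((i == l) && (k == j))%:R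
  - 24%:R * (mx7 form_tab i k * mx7 form_tab j l)
  - 12%:R * \sum_(m < 7) mx7 (cross_tab m) i k * mx7 (cocross_tab m) j l.
Proof.
have : all (fun i => all (fun j => all (fun k => all (fun l =>
    isum 14 (fun a => isum 14 (fun b =>
      entry dual_table a b * (entry (basis_tab a) i j * entry (basis_tab b) k l))) ==
    12%:R * ((i == j) && (k == l))%:R + 12%:R * ((i == l) && (k == j))%:R
    - 24%:R * (entry form_tab i k * entry form_tab j l)
    - 12%:R * isum 7 (fun m => entry (cross_tab m) i k * entry (cocross_tab m) j l))
  (iota 0 7)) (iota 0 7)) (iota 0 7)) (iota 0 7) by vm_compute.
move=> /all_iota0/(_ i)/all_iota0/(_ j)/all_iota0/(_ k)/all_iota0/(_ l)/eqP.
rewrite [isum 7 _]isumE; set S := \sum_(m < 7) _; set T := isum 14 _ => E.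
have /(congr1 (intr : int -> C)) := E; rewrite /T [isum 14 _]isumE rmorph_sum.
rewrite 2!rmorphB rmorphD /= 5!rmorphM /= !rmorph_nat /= rmorph_sum => {E T S}E.
transitivity (\sum_(a < 14) (isum 14 (fun b =>
      entry dual_table a b * (entry (basis_tab a) i j * entry (basis_tab b) k l)))%:~R : C).
  apply: eq_bigr => a _; rewrite isumE rmorph_sum; apply: eq_bigr => b _.
  by rewrite !mxE !rmorphM.
rewrite E !mxE; congr (_ - _ * _); apply: eq_bigr => m _.
by rewrite !mxE rmorphM.
Qed.

Lemma cocross_cross_dual (m n : 'I_7) :
  \sum_(i < 7) \sum_(k < 7) mx7 (cocross_tab m) i k * mx7 (cross_tab n) i k =
  6%:R * (m == n)%:R.
Proof.
have : all (fun m => all (fun n => isum 7 (fun i => isum 7 (fun k =>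
    entry (cocross_tab m) i k * entry (cross_tab n) i k)) == 6%:R * (m == n)%:R)
  (iota 0 7)) (iota 0 7) by vm_compute.
move=> /all_iota0/(_ m)/all_iota0/(_ n)/eqP/(congr1 (intr : int -> C)).
rewrite isumE rmorph_sum rmorphM !rmorph_nat => <-; apply: eq_bigr => i _.
by rewrite isumE rmorph_sum; apply: eq_bigr => k _; rewrite !mxE rmorphM.
Qed.

Lemma cross_tab_equivariant (a : 'I_14) (m : 'I_7) :
  mx7 (basis_tab a) *m mx7 (cross_tab m) + mx7 (cross_tab m) *m (mx7 (basis_tab a))^T =
  \sum_(n < 7) mx7 (basis_tab a) n m *: mx7 (cross_tab n).
Proof.
have : all (fun a => all (fun m => derive2 (basis_tab a) (cross_tab m) ==
    tabulate 7 (fun i k =>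
      isum 7 (fun n => entry (basis_tab a) n m * entry (cross_tab n) i k)))
  (iota 0 7)) (iota 0 14) by vm_compute.
move=> /all_iota0/(_ a)/all_iota0/(_ m)/eqP E; apply/matrixP => i k.
have /(congr1 (intr : int -> C)) := congr1 (fun t => entry t i k) E.
rewrite !entry_tabulate // !isumE !rmorph_sum !mxE summxE => eqE.
rewrite -big_split.
transitivity (\sum_(n < 7) (entry (basis_tab a) n m * entry (cross_tab n) i k)%:~R : C).
  rewrite -eqE; apply: eq_bigr => j _.
  by rewrite !mxE rmorphD !rmorphM.
by apply: eq_bigr => n _; rewrite !mxE rmorphM.
Qed.

Lemma form_tab_invariant (a : 'I_14) :
  mx7 (basis_tab a) *m mx7 form_tab + mx7 form_tab *m (mx7 (basis_tab a))^T = 0.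
Proof.
have : all (fun a => derive2 (basis_tab a) form_tab == tabulate 7 (fun _ _ => 0))
  (iota 0 14) by vm_compute.
move=> /all_iota0/(_ a)/eqP E; apply/matrixP => i k.
have /(congr1 (intr : int -> C)) := congr1 (fun t => entry t i k) E.
rewrite !entry_tabulate // isumE rmorph_sum !mxE -big_split => eqE; rewrite -[RHS]eqE.
by apply: eq_bigr => j _; rewrite !mxE rmorphD !rmorphM.
Qed.

Lemma form_tab_sqr : mx7 form_tab *m mx7 form_tab = 1%:M.
Proof.
have : all (fun i => all (fun k => isum 7 (fun j => entry form_tab i j * entry form_tab j k)
   == (i == k)%:R) (iota 0 7)) (iota 0 7) by vm_compute.
move=> E; apply/matrixP => i k; move: E => /all_iota0/(_ i)/all_iota0/(_ k)/eqP.
move=> /(congr1 (intr : int -> C)); rewrite isumE rmorph_sum rmorph_nat !mxE => <-.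
by apply: eq_bigr => j _; rewrite !mxE rmorphM.
Qed.

Lemma form_tab_sym : (mx7 form_tab)^T = mx7 form_tab.
Proof.
have : all (fun i => all (fun k => entry form_tab k i == entry form_tab i k)
  (iota 0 7)) (iota 0 7) by vm_compute.
move=> E; apply/matrixP => i k; move: E => /all_iota0/(_ i)/all_iota0/(_ k)/eqP E.
by rewrite !mxE E.
Qed.

Lemma cross_tab_antisym (m : 'I_7) : (mx7 (cross_tab m))^T = - mx7 (cross_tab m).
Proof.
have : all (fun m => all (fun i => all (fun k =>
    entry (cross_tab m) k i == - entry (cross_tab m) i k)
  (iota 0 7)) (iota 0 7)) (iota 0 7) by vm_compute.
move=> E; apply/matrixP => i k.
move: E => /all_iota0/(_ m)/all_iota0/(_ i)/all_iota0/(_ k)/eqP E.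
by rewrite !mxE E rmorphN.
Qed.

Lemma cocross_tabE (m : 'I_7) :
  mx7 (cocross_tab m) =
  mx7 form_tab *m (\sum_(n < 7) mx7 form_tab n m *: mx7 (cross_tab n)) *m mx7 form_tab.
Proof.
have : all (fun m => all (fun i => all (fun k => entry (cocross_tab m) i k ==
    isum 7 (fun l => isum 7 (fun j => entry form_tab i j *
      isum 7 (fun n => entry form_tab n m * entry (cross_tab n) j l)) * entry form_tab l k))
  (iota 0 7)) (iota 0 7)) (iota 0 7) by vm_compute.
move=> E; apply/matrixP => i k.
move: E => /all_iota0/(_ m)/all_iota0/(_ i)/all_iota0/(_ k)/eqP E.
rewrite mxE E isumE rmorph_sum !mxE; apply: eq_bigr => l _.
rewrite rmorphM !mxE isumE rmorph_sum; congr (_ * _); apply: eq_bigr => j _.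
rewrite rmorphM !mxE isumE rmorph_sum summxE; congr (_ * _); apply: eq_bigr => n _.
by rewrite rmorphM !mxE.
Qed.

End Casted.

(** * Standard form of an irreducible representation of dimension 7 *)

Lemma mulmx_cols (C : comPzRingType) (x : 'M[C]_7) (vs : seq 'cV[C]_7) l :
  (forall j : nat, (j < 7)%N ->
    x *m vs`_j = \sum_(i <- iota 0 7) (entry l i j)%:~R *: vs`_i) ->
  let P := \matrix_(i, j) (vs`_(j : 'I_7) : 'cV[C]_7) i 0 in x *m P = P *m mx7 C l.
Proof.
move=> xvs P; apply/matrixP => i j.
have -> : (x *m P) i j = (x *m vs`_j) i 0.
  by rewrite !mxE; apply: eq_bigr => k _; rewrite mxE.
rewrite xvs // -[iota 0 7]/(index_iota 0 7) big_mkord summxE mxE.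
by apply: eq_bigr => k _; rewrite !mxE mulrC.
Qed.

Section StandardBasis.
Variables (C : numClosedFieldType) (e0 e1 f0 f1 h0 h1 : 'M[C]_7).
Hypothesis h01 : h0 *m h1 = h1 *m h0.
Hypothesis ef00 : e0 *m f0 = f0 *m e0 + h0.
Hypothesis ef11 : e1 *m f1 = f1 *m e1 + h1.
Hypothesis ef01 : e0 *m f1 = f1 *m e0.
Hypothesis ef10 : e1 *m f0 = f0 *m e1.
Hypothesis he00 : h0 *m e0 = e0 *m h0 + 2%:R *: e0.
Hypothesis he01 : h0 *m e1 = e1 *m h0 + (- 1) *: e1.
Hypothesis he10 : h1 *m e0 = e0 *m h1 + (- 3%:R) *: e0.
Hypothesis he11 : h1 *m e1 = e1 *m h1 + 2%:R *: e1.
Hypothesis hf00 : h0 *m f0 = f0 *m h0 + (- 2%:R) *: f0.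
Hypothesis hf01 : h0 *m f1 = f1 *m h0 + 1 *: f1.
Hypothesis hf10 : h1 *m f0 = f0 *m h1 + 3%:R *: f0.
Hypothesis hf11 : h1 *m f1 = f1 *m h1 + (- 2%:R) *: f1.
(** [x *m M = M *m Y] says that the column space of [M] is stable under [x], and the right inverse
    says that it is the whole space. *)
Hypothesis irr : forall m (M : 'M[C]_(7, m)), M != 0 ->
  (forall x, x \in [:: e0; e1; f0; f1; h0; h1] -> exists Y, x *m M = M *m Y) ->
  exists N, M *m N = 1%:M.

(** The commuting matrices [h0] and [h1] have a common eigenvector over an algebraically closed
    field; transposition turns it from a row into a column. *)
Lemma weight_vector : exists2 u : 'cV[C]_7, u != 0 &
  exists a b, h0 *m u = a *: u /\ h1 *m u = b *: u.
Proof.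
have h01T : h0^T *m h1^T = h1^T *m h0^T by rewrite -!trmx_mul h01.
have [//|v v0 /andP[]] := common_eigenvector2 _ h01T.
move=> /sub_rVP[a ha] /sub_rVP[b hb].
exists v^T; first by rewrite trmx_eq0.
by exists a, b; split; apply: trmx_inj; rewrite trmx_mul trmxK linearZ /= trmxK.
Qed.

(* 5 h0 + 3 h1 takes the value 1 on both simple roots. *)
Lemma highest_weight_vector : exists2 u : 'cV[C]_7, u != 0 &
  [/\ e0 *m u = 0, e1 *m u = 0 &
    exists a b, h0 *m u = a *: u /\ h1 *m u = b *: u].
Proof.
pose wtv (a b : C) (u : 'cV[C]_7) := h0 *m u = a *: u /\ h1 *m u = b *: u.
have [u0 u0N0 [a0 [b0 wtu0]]] := weight_vector.
have e0_wt a b u : wtv a b u -> wtv (a + 2%:R) (b - 3%:R) (e0 *m u).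
  by case=> ? ?; split; apply: eigen_shift.
have e1_wt a b u : wtv a b u -> wtv (a - 1) (b + 2%:R) (e1 *m u).
  by case=> ? ?; split; apply: eigen_shift.
pose p := 5%:R * a0 + 3%:R * b0.
have [//|no_hw] := pselect (exists2 u : 'cV[C]_7, u != 0 &
  [/\ e0 *m u = 0, e1 *m u = 0 & exists a b, wtv a b u]).
(* Without a highest weight vector every weight vector could be raised by [e0] or [e1], so
   [5 h0 + 3 h1] would have the eight eigenvalues [p, p + 1, ..., p + 7]. *)
have raise n : exists2 u : 'cV[C]_7, u != 0 & exists a b,
    wtv a b u /\ 5%:R * a + 3%:R * b = p + n%:R.
  elim: n => [|n [u uN0 [a [b [wtu ab]]]]].
    by exists u0 => //; exists a0, b0; rewrite addr0.
  have [e0u|e0u] := eqVneq (e0 *m u) 0; last first.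
    exists (e0 *m u) => //; exists (a + 2%:R), (b - 3%:R); split; first exact: e0_wt.
    by rewrite -(natr1 n) [RHS]addrA -ab; ring.
  have [e1u|e1u] := eqVneq (e1 *m u) 0; last first.
    exists (e1 *m u) => //; exists (a - 1), (b + 2%:R); split; first exact: e1_wt.
    by rewrite -(natr1 n) [RHS]addrA -ab; ring.
  by case: no_hw; exists u => //; split=> //; exists a, b.
suff : (size [seq (p + n%:R)%R | n <- iota 0 8] <= 7)%N.
  by rewrite size_map size_iota.
apply: (@distinct_eigenvalues _ _ (5%:R *: h0 + 3%:R *: h1)).
  by rewrite map_inj_uniq ?iota_uniq // => i j /addrI/eqP; rewrite eqr_nat => /eqP.
move=> c /mapP[n _ ->]; have [u uN0 [a [b [[ha hb] <-]]]] := raise n.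
by exists u => //; rewrite mulmxDl -!scalemxAl ha hb !scalerA -scalerDl.
Qed.

Section Weights.
Variables (a b : nat) (v : 'cV[C]_7).
Hypothesis v_neq0 : v != 0.
Hypothesis e0v : e0 *m v = 0.
Hypothesis e1v : e1 *m v = 0.
Hypothesis h0v : h0 *m v = a%:R *: v.
Hypothesis h1v : h1 *m v = b%:R *: v.

(* the weight (a, b) - j alpha0 - k alpha1, where e0 has weight
   alpha0 = (2, -3) and e1 has weight alpha1 = (-1, 2) *)
Let wt j k (u : 'cV[C]_7) :=
  h0 *m u = (a%:R - 2%:R *+ j + 1 *+ k) *: u /\
  h1 *m u = (b%:R + 3%:R *+ j - 2%:R *+ k) *: u.

Let wt0 : wt 0 0 v. Proof. by split; rewrite !mulr0n ?subr0 !addr0. Qed.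

Let wtF0 j k i u : wt j k u -> wt (j + i) k (iter i (mulmx f0) u).
Proof.
case=> hu0 hu1; split.
  by rewrite (eigen_shift_iter i hf00 hu0); congr (_ *: _); ring.
by rewrite (eigen_shift_iter i hf10 hu1); congr (_ *: _); ring.
Qed.

Let wtF1 j k i u : wt j k u -> wt j (k + i) (iter i (mulmx f1) u).
Proof.
case=> hu0 hu1; split.
  by rewrite (eigen_shift_iter i hf01 hu0); congr (_ *: _); ring.
by rewrite (eigen_shift_iter i hf11 hu1); congr (_ *: _); ring.
Qed.

Let wt_nat0 j k n u : wt j k u -> (a + k = n + 2 * j)%N -> h0 *m u = n%:R *: u.
Proof.
case=> -> _ /(congr1 (GRing.natmul (1 : C))); rewrite natrD [in RHS]natrD natrM => E.
by congr (_ *: _); apply: (addIr (2%:R * j%:R)); rewrite -E; ring.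
Qed.

Let wt_nat1 j k n u : wt j k u -> (b + 3 * j = n + 2 * k)%N -> h1 *m u = n%:R *: u.
Proof.
case=> _ -> /(congr1 (GRing.natmul (1 : C))); rewrite natrD [in RHS]natrD !natrM => E.
by congr (_ *: _); apply: (addIr (2%:R * k%:R)); rewrite -E; ring.
Qed.

Let present j k := exists2 u : 'cV[C]_7, u != 0 & wt j k u.

Let chain0 j k n i u : u != 0 -> wt j k u -> e0 *m u = 0 ->
  (a + k = n + 2 * j)%N -> (i <= n)%N ->
  iter i (mulmx f0) u != 0 /\ wt (j + i) k (iter i (mulmx f0) u).
Proof.
move=> u0 wu eu E le_in; split; last exact: wtF0.
exact: (sl2_iter_neq0 ef00 hf00 u0 eu (wt_nat0 wu E)).
Qed.

Let chain1 j k n i u : u != 0 -> wt j k u -> e1 *m u = 0 ->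
  (b + 3 * j = n + 2 * k)%N -> (i <= n)%N ->
  iter i (mulmx f1) u != 0 /\ wt j (k + i) (iter i (mulmx f1) u).
Proof.
move=> u0 wu eu E le_in; split; last exact: wtF1.
exact: (sl2_iter_neq0 ef11 hf11 u0 eu (wt_nat1 wu E)).
Qed.

(* 23 h0 + 12 h1 takes the value 10 on alpha0 and 1 on alpha1. *)
Let present_count (s : seq (nat * nat)) :
  uniq [seq (10 * jk.1 + jk.2)%N | jk <- s] ->
  foldr (fun jk P => present jk.1 jk.2 /\ P) True s -> (size s <= 7)%N.
Proof.
move=> s_uniq s_pres; pose c (n : nat) : C := 23%:R * a%:R + 12%:R * b%:R - n%:R.
rewrite -(size_map (fun jk => c (10 * jk.1 + jk.2)%N)).
apply: (@distinct_eigenvalues _ _ (23%:R *: h0 + 12%:R *: h1)).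
  rewrite (map_comp c) map_inj_uniq // => i j /addrI/oppr_inj/eqP.
  by rewrite eqr_nat => /eqP.
have {s_uniq s_pres} : forall jk, jk \in s -> present jk.1 jk.2.
  elim: s s_pres {s_uniq} => //= p s IHs [p_pres /IHs s_pres] jk.
  by rewrite inE => /predU1P[->|/s_pres].
move=> s_pres _ /mapP[[j k] /s_pres[u u0 [/= hu0 hu1]] ->]; exists u => //.
rewrite mulmxDl -!scalemxAl hu0 hu1 !scalerA -scalerDl; congr (_ *: _).
rewrite /c natrD natrM; ring.
Qed.

(** Apart from [(0, 0)], excluded by irreducibility, each other highest weight is refuted by eight
    pairs [(j, k)], standing for the weights [(a, b) - j alpha0 - k alpha1]. *)
Lemma highest_weight_fundamental : a = 0%N /\ b = 1%N.
Proof.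
have [a0 | a_gt0] := posnP a; last first.
  (* [f0 v] is nonzero, is killed by [e1] and has [h1]-weight [b + 3], so [f1] can be applied
     [b + 3] times. *)
  exfalso; have [f0v wf0v] := @chain0 _ _ a 1 _ v_neq0 wt0 e0v erefl a_gt0.
  have e1f0 k : e1 *m iter k (mulmx f0) v = 0 by rewrite comm_iter // e1v iter_mulmx0.
  have e0f1 k : e0 *m iter k (mulmx f1) v = 0 by rewrite comm_iter // e0v iter_mulmx0.
  have p1 i : (i <= b + 3)%N -> present 1 i.
    move=> ib; have [] := @chain1 1 0 (b + 3) i _ f0v wf0v (e1f0 1%N) (esym (addn0 _)) ib.
    by exists (iter i (mulmx f1) (iter 1 (mulmx f0) v)).
  have p0 i : (i <= b)%N -> present 0 i.
    move=> ib; have [] := @chain1 0 0 b i _ v_neq0 wt0 e1v erefl ib.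
    by exists (iter i (mulmx f1) v).
  have [b_ge2 | b_lt2] := leqP 2 b.
    suff : (8 <= 7)%N by [].
    apply: (@present_count
      [:: (0,0); (0,1); (0,2); (1,0); (1,1); (1,2); (1,3); (1,4)]%N) => //=.
    by do !split; (apply: p0 || apply: p1); lia.
  have [b1 | b0] : b = 1%N \/ b = 0%N by lia.
    suff : (8 <= 7)%N by [].
    apply: (@present_count
      [:: (0,0); (0,1); (1,0); (1,1); (1,2); (1,3); (1,4); (2,1)]%N) => //=.
    do !split; try by (apply: p0 || apply: p1); lia.
    have b_gt0 : (1 <= b)%N by rewrite b1.
    (* [f1 v] is killed by [e0] and has [h0]-weight [a + 1 >= 2], so two steps by [f0] reach
       [(2, 1)]. *)
    have [f1v wf1v] := @chain1 _ _ b 1 _ v_neq0 wt0 e1v erefl b_gt0.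
    have [] := @chain0 0 1 (a + 1) 2 _ f1v wf1v (e0f1 1%N) (esym (addn0 _)); first by lia.
    by exists (iter 2 (mulmx f0) (iter 1 (mulmx f1) v)).
  have [a_ge2 | a_lt2] := leqP 2 a.
    suff : (8 <= 7)%N by [].
    apply: (@present_count
      [:: (0,0); (1,0); (1,1); (1,2); (1,3); (2,0); (2,1); (2,2)]%N) => //=.
    have [f0v2 wf0v2] := @chain0 _ _ a 2 _ v_neq0 wt0 e0v erefl a_ge2.
    have p2 i : (i <= 6)%N -> present 2 i.
      move=> i6; have [] := @chain1 2 0 6 i _ f0v2 wf0v2 (e1f0 2%N) _ i6; first by rewrite b0.
      by exists (iter i (mulmx f1) (iter 2 (mulmx f0) v)).
    by do !split; (apply: p2 || apply: p0 || apply: p1); lia.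
  have a1 : a = 1%N by lia.
  suff : (8 <= 7)%N by [].
  apply: (@present_count [:: (0,0); (1,0); (1,1); (1,2); (1,3); (2,2); (2,3); (3,3)]%N) => //=.
  have f1v0 : f1 *m v = 0.
    by apply: (sl2_iter_eq0 (n := 0) ef11 hf11) => //; rewrite h1v b0.
  (* This is the highest weight of the adjoint representation. Here
     [e0 f1^(k+1) f0 v = f1^(k+1) h0 v = 0], so [f0] can be applied [k] times to [f1^(k+1) f0 v],
     which has [h0]-weight [k]. *)
  have p2 j k : (k < 3)%N -> (j <= k)%N -> present (1 + j) k.+1.
    move=> k3 jk; have k4 : (k.+1 <= 3)%N by [].
    have [u0 wu] := @chain1 1 0 3 k.+1 _ f0v wf0v (e1f0 1%N) (ltac:(lia)) k4.
    have [] := @chain0 1 k.+1 k j _ u0 wu _ _ jk.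
    - rewrite comm_iter //= mulmxA ef00 mulmxDl -mulmxA e0v mulmx0 add0r h0v.
      by rewrite -iterS iterSr -scalemxAr f1v0 scaler0 iter_mulmx0.
    - by rewrite a1 mul2n; lia.
    by exists (iter j (mulmx f0) (iter k.+1 (mulmx f1) (iter 1 (mulmx f0) v))).
  by do !split; (apply: p0 || apply: p1 || apply: (p2 1%N) || apply: (p2 2%N)); lia.
have e0f1 k : e0 *m iter k (mulmx f1) v = 0 by rewrite comm_iter // e0v iter_mulmx0.
have p j k : (j <= k)%N -> (k <= b)%N -> present j k.
  move=> jk kb; have [u0 wu] := @chain1 0 0 b k _ v_neq0 wt0 e1v erefl kb.
  have [] := @chain0 0 k k j _ u0 wu (e0f1 k) _ jk; first by rewrite a0 addn0.
  by exists (iter j (mulmx f0) (iter k (mulmx f1) v)).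
split=> //; have [b_ge3 | b_lt3] := leqP 3 b.
  exfalso; suff : (8 <= 7)%N by [].
  apply: (@present_count [:: (0,0); (0,1); (0,2); (0,3); (1,1); (1,2); (1,3); (2,2)]%N) => //=.
  by do !split; apply: p; lia.
have [//|[b2|b0]] : b = 1%N \/ b = 2%N \/ b = 0%N by lia.
  exfalso; suff : (8 <= 7)%N by [].
  apply: (@present_count [:: (0,0); (0,1); (0,2); (1,1); (1,2); (2,2); (2,3); (2,4)]%N) => //=.
  have b_ge2 : (2 <= b)%N by rewrite b2.
  have [u0 wu] := @chain1 0 0 b 2 _ v_neq0 wt0 e1v erefl b_ge2.
  have [] := @chain0 0 2 2 2 _ u0 wu (e0f1 2%N) _ (leqnn _); first by rewrite a0.
  set w := iter 2 (mulmx f0) _ => w0 ww.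
  (* [e1 f1^2 v] is a multiple of [f1 v], which has [h0]-weight [1] and is therefore killed by
     [f0^2]. Hence [w], of [h1]-weight [4], starts an [f1]-string. *)
  have e1w : e1 *m w = 0.
    rewrite /w comm_iter // (sl2_raise ef11 hf11 1 e1v h1v).
    apply: (sl2_iter_eq0 (n := 1) ef00 hf00).
      by rewrite -scalemxAr e0f1 scaler0.
    have hw : h0 *m iter 1 (mulmx f1) v = 1%:R *: iter 1 (mulmx f1) v.
      by apply: (wt_nat0 (wtF1 1 wt0)); rewrite a0.
    by rewrite -scalemxAr hw !scale1r.
  have p2 i : (i <= 4)%N -> present 2 (2 + i).
    move=> i4; have [] := @chain1 2 2 4 i _ w0 ww e1w _ i4; first by rewrite b2.
    by exists (iter i (mulmx f1) w).
  by do !split; try (by apply: p; lia); [apply: (p2 1%N) | apply: (p2 2%N)].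
have f0v : f0 *m v = 0.
  by apply: (sl2_iter_eq0 (n := 0) ef00 hf00) => //; rewrite h0v a0.
have f1v : f1 *m v = 0.
  by apply: (sl2_iter_eq0 (n := 0) ef11 hf11) => //; rewrite h1v b0.
(* For the weight [(0, 0)] all generators kill [v], so [irr] would give rank 7 to a single
   column. *)
have [x|N vN] := irr v_neq0.
  by rewrite !inE => /or4P[||| /or3P[||]] /eqP ->; exists 0;
    rewrite mulmx0 // ?h0v ?h1v ?a0 ?b0 scale0r.
have := mxrankM_maxl v N; rewrite vN mxrank1 => /leq_trans/(_ (rank_leq_col v)).
by [].
Qed.

End Weights.

(** The basis is obtained from a highest weight vector by applying [f1, f0, f1, f1, f0, f1] in turn.
    The images under [e0] and [e1] follow by moving these past the last factor, and those under [f0]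
    and [f1] vanish where the weights end a string. *)
Lemma G2_standard_basis : exists2 P : 'M[C]_7, P \in unitmx &
  [/\ e0 *m P = P *m mx7 C tabE0, e1 *m P = P *m mx7 C tabE1,
      f0 *m P = P *m mx7 C tabF0 & f1 *m P = P *m mx7 C tabF1].
Proof.
have [v0 v0N0 [e0v0 e1v0 [a' [b' [h0v0 h1v0]]]]] :=
  highest_weight_vector.
have [a Da _] := sl2_weight_nat ef00 hf00 v0N0 e0v0 h0v0.
have [b Db _] := sl2_weight_nat ef11 hf11 v0N0 e1v0 h1v0.
rewrite {a'}Da in h0v0; rewrite {b'}Db in h1v0.
have [a0 b1] : a = 0%N /\ b = 1%N.
  exact: (highest_weight_fundamental v0N0).
rewrite {a}a0 {b}b1 in h0v0 h1v0.
pose v1 := f1 *m v0; pose v2 := f0 *m v1; pose v3 := f1 *m v2.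
pose v4 := f1 *m v3; pose v5 := f0 *m v4; pose v6 := f1 *m v5.
have efE (e f h : 'M[C]_7) (u w : 'cV[C]_7) (c : C) : e *m f = f *m e + h ->
    e *m u = w -> h *m u = c *: u -> e *m (f *m u) = f *m w + c *: u.
  by move=> ef eu hu; rewrite mulmxA ef mulmxDl -mulmxA eu hu.
have efC (e f : 'M[C]_7) (u : 'cV[C]_7) : e *m f = f *m e ->
    e *m (f *m u) = f *m (e *m u).
  by move=> ef; rewrite !mulmxA ef.
have hE (h x : 'M[C]_7) (u : 'cV[C]_7) (a c d : C) : h *m x = x *m h + a *: x ->
    h *m u = c *: u -> c + a = d -> h *m (x *m u) = d *: (x *m u).
  by move=> hx hu <-; apply: eigen_shift.
have h0v1 : h0 *m v1 = 1%:R *: v1 by apply: (hE _ _ _ _ _ _ hf01 h0v0); ring.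
have h1v1 : h1 *m v1 = -1 *: v1 by apply: (hE _ _ _ _ _ _ hf11 h1v0); ring.
have h1v2 : h1 *m v2 = 2%:R *: v2 by apply: (hE _ _ _ _ _ _ hf10 h1v1); ring.
have h0v2 : h0 *m v2 = -1 *: v2 by apply: (hE _ _ _ _ _ _ hf00 h0v1); ring.
have h1v3 : h1 *m v3 = 0%:R *: v3 by apply: (hE _ _ _ _ _ _ hf11 h1v2); ring.
have h0v3 : h0 *m v3 = 0%:R *: v3 by apply: (hE _ _ _ _ _ _ hf01 h0v2); ring.
have h0v4 : h0 *m v4 = 1%:R *: v4 by apply: (hE _ _ _ _ _ _ hf01 h0v3); ring.
have h1v4 : h1 *m v4 = - 2%:R *: v4 by apply: (hE _ _ _ _ _ _ hf11 h1v3); ring.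
have h0v5 : h0 *m v5 = -1 *: v5 by apply: (hE _ _ _ _ _ _ hf00 h0v4); ring.
have h1v5 : h1 *m v5 = 1%:R *: v5 by apply: (hE _ _ _ _ _ _ hf10 h1v4); ring.
have h0v6 : h0 *m v6 = 0%:R *: v6 by apply: (hE _ _ _ _ _ _ hf01 h0v5); ring.
have f0v0 : f0 *m v0 = 0 := sl2_iter_eq0 ef00 hf00 e0v0 h0v0.
have f1v1 : f1 *m v1 = 0 := sl2_iter_eq0 ef11 hf11 e1v0 h1v0.
have e0v1 : e0 *m v1 = 0 by rewrite efC // e0v0 mulmx0.
have e1v1 : e1 *m v1 = v0 by rewrite (efE _ _ _ _ _ _ ef11 e1v0 h1v0) mulmx0 add0r scale1r.
have f0v2 : f0 *m v2 = 0 := sl2_iter_eq0 ef00 hf00 e0v1 h0v1.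
have e0v2 : e0 *m v2 = v1 by rewrite (efE _ _ _ _ _ _ ef00 e0v1 h0v1) mulmx0 add0r scale1r.
have e1v2 : e1 *m v2 = 0 by rewrite efC // e1v1.
have e0v3 : e0 *m v3 = 0 by rewrite efC // e0v2.
have e1v3 : e1 *m v3 = 2%:R *: v2 by rewrite (efE _ _ _ _ _ _ ef11 e1v2 h1v2) mulmx0 add0r.
have f0v3 : f0 *m v3 = 0 := sl2_iter_eq0 ef00 hf00 e0v3 h0v3.
have f1v4 : f1 *m v4 = 0 := sl2_iter_eq0 ef11 hf11 e1v2 h1v2.
have e0v4 : e0 *m v4 = 0 by rewrite efC // e0v3 mulmx0.
have e1v4 : e1 *m v4 = 2%:R *: v3.
  by rewrite (efE _ _ _ _ _ _ ef11 e1v3 h1v3) scale0r addr0 -scalemxAr.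
have e0v5 : e0 *m v5 = v4 by rewrite (efE _ _ _ _ _ _ ef00 e0v4 h0v4) mulmx0 add0r scale1r.
have f0v5 : f0 *m v5 = 0 := sl2_iter_eq0 ef00 hf00 e0v4 h0v4.
have e1v5 : e1 *m v5 = 0 by rewrite efC // e1v4 -scalemxAr f0v3 scaler0.
have e1v6 : e1 *m v6 = v5 by rewrite (efE _ _ _ _ _ _ ef11 e1v5 h1v5) mulmx0 add0r scale1r.
have e0v6 : e0 *m v6 = 0 by rewrite efC // e0v5.
have f1v6 : f1 *m v6 = 0 := sl2_iter_eq0 ef11 hf11 e1v5 h1v5.
have f0v6 : f0 *m v6 = 0 := sl2_iter_eq0 ef00 hf00 e0v6 h0v6.
pose vs := [:: v0; v1; v2; v3; v4; v5; v6].
pose P : 'M[C]_7 := \matrix_(i, j) (vs`_(j : 'I_7) : 'cV[C]_7) i 0.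
have simpE := (scale0r, scale1r, add0r, addr0).
have e0P : e0 *m P = P *m mx7 C tabE0.
  apply: mulmx_cols => -[|[|[|[|[|[|[|]]]]]]] //= _;
  by rewrite !big_cons big_nil /= /entry /= !simpE.
have e1P : e1 *m P = P *m mx7 C tabE1.
  apply: mulmx_cols => -[|[|[|[|[|[|[|]]]]]]] //= _;
  by rewrite !big_cons big_nil /= /entry /= !simpE.
have f0P : f0 *m P = P *m mx7 C tabF0.
  apply: mulmx_cols => -[|[|[|[|[|[|[|]]]]]]] //= _;
  by rewrite !big_cons big_nil /= /entry /= !simpE.
have f1P : f1 *m P = P *m mx7 C tabF1.
  apply: mulmx_cols => -[|[|[|[|[|[|[|]]]]]]] //= _;
  by rewrite !big_cons big_nil /= /entry /= !simpE.
exists P => //.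
(* [P] is invertible by [irr]: its column space is nonzero and stable under the generators, [h0] and
   [h1] being commutators of the others. *)
have P0 : P != 0.
  apply: contraNneq v0N0 => /matrixP P0; apply/eqP/matrixP => i j.
  by rewrite (ord1 j); have := P0 i 0; rewrite !mxE.
have [x|N PN] := irr P0; last by have [] := mulmx1_unit PN.
have {}hP (e f h : 'M[C]_7) l l' : e *m P = P *m mx7 C l -> f *m P = P *m mx7 C l' ->
    e *m f = f *m e + h -> exists Y, h *m P = P *m Y.
  move=> eP fP /eqP; rewrite addrC -subr_eq => /eqP <-.
  exists (mx7 C l *m mx7 C l' - mx7 C l' *m mx7 C l).
  by rewrite mulmxBl mulmxBr -!mulmxA fP eP !mulmxA eP fP.
by rewrite !inE => /or4P[||| /or3P[||]] /eqP ->; eauto.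
Qed.

End StandardBasis.

(** * Traces, Killing form and Casimir tensor in a basis *)

Lemma linear_sum_scale (K : pzRingType) (U V : lmodType K) (f : U -> V) :
  linear f -> forall n (c : 'I_n -> K) (x : 'I_n -> U),
  f (\sum_i c i *: x i) = \sum_i c i *: f (x i).
Proof.
move=> f_lin n c x.
pose fL : {linear U -> V} := HB.pack f (GRing.isLinear.Build _ _ _ _ f f_lin).
rewrite -[f]/(fL : U -> V) linear_sum; apply: eq_bigr => i _; exact: linearZ.
Qed.

Lemma linear_map0 (K : pzRingType) (U V : lmodType K) (f : U -> V) : linear f -> f 0 = 0.
Proof.
move=> f_lin; have := linear_sum_scale f_lin (fun _ : 'I_0 => 0) (fun=> 0).
by rewrite !big_ord0.
Qed.

Lemma linear_mapZ (K : pzRingType) (U V : lmodType K) (f : U -> V) :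
  linear f -> forall a x, f (a *: x) = a *: f x.
Proof. by move=> f_lin a x; rewrite -[a *: x]addr0 f_lin linear_map0 // addr0. Qed.

(** A subspace of maximal dimension inside [p] contains every [x] satisfying [p], since adding the
    line of [x] would otherwise enlarge it. *)
Lemma vspace_of_pred (K : fieldType) (V : vectType K) (p : V -> Prop) :
  p 0 -> (forall a x y, p x -> p y -> p (a *: x + y)) ->
  exists U : {vspace V}, forall x, x \in U <-> p x.
Proof.
move=> p0 pL.
pose Q n := `[< exists2 U : {vspace V}, \dim U = n & forall x, x \in U -> p x >].
have exQ : exists n, Q n.
  exists 0%N; apply/asboolP; exists 0%VS; first exact: dimv0.
  by move=> x; rewrite memv0 => /eqP ->.
have leQ n : Q n -> (n <= \dim {:V})%N by move=> /asboolP[U <- _]; exact/dimvS/subvf.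
case: (ex_maxnP exQ leQ) => n /asboolP[U dimU Up] maxU; exists U => x.
split=> [/Up//|px]; apply/negP => /negP xU.
have /maxU : Q (\dim (<[x]> + U)).
  apply/asboolP; exists (<[x]> + U)%VS => // y /memv_addP[_ /vlineP[a ->]] [u /Up pu ->].
  exact: pL.
rewrite leqNgt -dimU => /negP; apply; rewrite ltn_neqAle dimvS ?addvSr // andbT.
apply: contra xU => /eqP dimE; have /eqP -> : (U == <[x]> + U)%VS.
  by rewrite -dimv_leqif_eq ?addvSr // dimE.
by rewrite memvE addvSl.
Qed.

(** The trace does not depend on the basis: expand [b] in [b'], exchange the sums, and expand
    [phi b'_a] in [b]. *)
Lemma coord_trace (K : fieldType) (V : vectType K) m n (b : m.-tuple V)
    (b' : n.-tuple V) (phi : V -> V) :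
  linear phi -> basis_of fullv b -> basis_of fullv b' ->
  \sum_i coord b i (phi b`_i) = \sum_a coord b' a (phi b'`_a).
Proof.
move=> phi_lin bB b'B.
transitivity (\sum_(i < m) \sum_(a < n) coord b' a b`_i * coord b i (phi b'`_a)).
  apply: eq_bigr => i _; rewrite {1}(coord_basis b'B (memvf b`_i)).
  rewrite linear_sum_scale // linear_sum; apply: eq_bigr => a _.
  by rewrite linearZ.
rewrite exchange_big; apply: eq_bigr => a _.
rewrite {2}(coord_basis bB (memvf (phi _))) linear_sum.
by apply: eq_bigr => i _; rewrite linearZ mulrC.
Qed.

Section LieBasis.
Variables (K : fieldType) (g : vectType K) (br : g -> g -> g).
Hypothesis br_lie : is_lie_bracket br.

Lemma br_linearl y : linear (br^~ y).
Proof. by case: br_lie => brl _ _ _ a x z; exact: brl. Qed.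

Lemma br_linearr x : linear (br x).
Proof. by case: br_lie => _ brr _ _ a y z; exact: brr. Qed.

Lemma ad_comp_linear x y : linear (fun z => br x (br y z)).
Proof. by move=> a z t; rewrite !br_linearr. Qed.

Lemma killing_basis n (b : n.-tuple g) x y : basis_of fullv b ->
  killing br x y = \sum_a coord b a (br x (br y b`_a)).
Proof.
move=> bB.
exact: (coord_trace (b := vbasis {:g}) (ad_comp_linear x y) (vbasisP _) bB).
Qed.

Lemma killing_linearl y : linear (fun x => killing br x y : K^o).
Proof.
move=> a x z; rewrite /killing scaler_sumr -big_split; apply: eq_bigr => i _.
by rewrite br_linearl linearP.
Qed.

Lemma killing_linearr x : linear (fun y => killing br x y : K^o).
Proof.
move=> a y z; rewrite /killing scaler_sumr -big_split; apply: eq_bigr => i _.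
by rewrite br_linearl br_linearr linearP.
Qed.

(** With transition matrices [S] and [T = S^-1], the Gram matrix is [T M T^T], so its inverse is
    [S^T N S], and the factors [S] are absorbed into the basis vectors. The bilinear map [t] stands
    for the tensor product. *)
Lemma casimir_tensor_basis (W : lmodType K) (t : g -> g -> W) (h : K) n
    (b : n.-tuple g) (N : 'M[K]_n) :
  (forall y, linear (t^~ y)) -> (forall x, linear (t x)) ->
  basis_of fullv b ->
  (\matrix_(i, j) (h * killing br b`_i b`_j)) *m N = 1%:M ->
  let bs := vbasis {:g} in
  let gram : 'M[K]_(\dim {:g}) := \matrix_(i, j) (h * killing br bs`_i bs`_j) in
  \sum_i \sum_j invmx gram i j *: t bs`_i bs`_j =
  \sum_a \sum_c N a c *: t b`_a b`_c.
Proof.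
move=> tl tr bB MN bs gram; have bsB := vbasisP {:g}; rewrite -/bs in bsB.
set M := \matrix_(i, j) _ in MN.
pose S := \matrix_(a < n, i < \dim {:g}) coord bs i b`_a.
pose T := \matrix_(i < \dim {:g}, a < n) coord b a bs`_i.
have TS : T *m S = 1%:M.
  apply/matrixP => i j; rewrite !mxE -(coord_free _ _ (basis_free bsB)).
  rewrite [in RHS](coord_basis bB (memvf bs`_i)) linear_sum.
  by apply: eq_bigr => a _; rewrite !mxE linearZ.
have ST : S *m T = 1%:M.
  apply/matrixP => i j; rewrite !mxE -(coord_free _ _ (basis_free bB)).
  rewrite [in RHS](coord_basis bsB (memvf b`_i)) linear_sum.
  by apply: eq_bigr => a _; rewrite !mxE linearZ.
have gramE : gram = T *m M *m T^T.
  apply/matrixP => i j; rewrite !mxE.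
  rewrite [in LHS](coord_basis bB (memvf bs`_j)).
  rewrite (linear_sum_scale (killing_linearr _)) mulr_sumr; apply: eq_bigr => c _.
  rewrite [in LHS](coord_basis bB (memvf bs`_i)) !mxE.
  rewrite (linear_sum_scale (killing_linearl _)) mulr_suml scaler_sumr mulr_sumr.
  apply: eq_bigr => a _; rewrite !mxE /GRing.scale /=; ring.
have gramV : gram *m (S^T *m N *m S) = 1%:M.
  rewrite gramE -!mulmxA (mulmxA T^T) -trmx_mul ST trmx1 mul1mx.
  by rewrite (mulmxA M) MN mul1mx.
have [gram_unit _] := mulmx1_unit gramV.
have -> : invmx gram = S^T *m N *m S.
  by rewrite -[RHS](mulKmx gram_unit) gramV mulmx1.
transitivity (\sum_(a < n) \sum_(c < n) N a c *:
   \sum_(i < \dim {:g}) S a i *: \sum_(j < \dim {:g}) S c j *: t bs`_i bs`_j); last first.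
  apply: eq_bigr => a _; apply: eq_bigr => c _; congr (_ *: _).
  rewrite [in RHS](coord_basis bsB (memvf b`_a)) (linear_sum_scale (tl _)).
  apply: eq_bigr => i _; rewrite mxE; congr (_ *: _).
  rewrite [in RHS](coord_basis bsB (memvf b`_c)) (linear_sum_scale (tr _)).
  by apply: eq_bigr => j _; rewrite mxE.
(* Both sides are fourfold sums of [X]; indexing them by pairs of pairs allows a single exchange. *)
pose X a c i j := (S a i * N a c * S c j) *: t bs`_i bs`_j.
transitivity (\sum_(p : 'I_n * 'I_n) \sum_(q : 'I_(\dim {:g}) * 'I_(\dim {:g}))
    X p.1 p.2 q.1 q.2).
  rewrite [RHS]exchange_big [LHS]pair_bigA; apply: eq_bigr => -[i j] _ /=.
  rewrite mxE scaler_suml -(pair_bigA _ (fun a c => X a c i j)) exchange_big /=.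
  apply: eq_bigr => c _; rewrite mxE mulr_suml scaler_suml.
  by apply: eq_bigr => a _; rewrite [S^T _ _]mxE.
rewrite [RHS]pair_bigA; apply: eq_bigr => -[a c] _ /=.
rewrite -(pair_bigA _ (X a c)) scaler_sumr; apply: eq_bigr => i _.
rewrite !scaler_sumr; apply: eq_bigr => j _; rewrite !scalerA; congr (_ *: _); ring.
Qed.

End LieBasis.

(** [G2_tabs] stores evaluated matrices; their form as iterated commutators is what matches the
    brackets in [g]. *)
Lemma G2_tabsE : G2_tabs = lie_basis commutator tabE0 tabE1 tabF0 tabF1 tabH0 tabH1.
Proof. by vm_compute. Qed.

(** * A basis of the Lie algebra adapted to the standard form *)

Section G2Rep.
Variables (C : numClosedFieldType) (g : vectType C) (br : g -> g -> g).
Variable rho : g -> 'M[C]_7.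
Hypotheses (br_lie : is_lie_bracket br) (g_simple : lie_simple br).
Hypotheses (g_G2 : lie_type_G2 br) (rho_rep : is_lie_rep br rho).
Hypothesis rho_irr : lie_irreducible rho.

Lemma invariant_span_full m (M : 'M[C]_(7, m)) : M != 0 ->
  (forall x, exists Y, rho x *m M = M *m Y) -> exists N, M *m N = 1%:M.
Proof.
move=> M0 rhoM; case: rho_irr => _ irr.
have [||U UE] := @vspace_of_pred _ _ (fun u : 'cV[C]_7 => exists y, u = M *m y).
- by exists 0; rewrite mulmx0.
- by move=> a _ _ [y ->] [z ->]; exists (a *: y + z); rewrite mulmxDr scalemxAr.
have MU y : M *m y \in U by apply/UE; exists y.
have [|U0|UT] := irr U.
- move=> x _ /UE[y ->]; have [Y rhoY] := rhoM x.
  by rewrite mulmxA rhoY -mulmxA.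
- case/eqP: M0; apply/matrixP => i j; have := MU (delta_mx j 0).
  by rewrite U0 memv0 -colE => /eqP/matrixP/(_ i 0); rewrite !mxE.
suff /submxP[N /(congr1 trmx)] : (1%:M <= M^T)%MS.
  by rewrite trmx1 trmx_mul trmxK; exists N^T.
apply/row_subP => i; have /UE[y /(congr1 trmx)] : (row i 1%:M)^T \in U by rewrite UT memvf.
by rewrite trmxK trmx_mul => ->; exact: submxMl.
Qed.

Lemma rho_linear : linear rho. Proof. by case: rho_rep. Qed.

Lemma rhoZ a x : rho (a *: x) = a *: rho x.
Proof. exact: linear_mapZ rho_linear _ _. Qed.

Lemma rho0 : rho 0 = 0. Proof. exact: linear_map0 rho_linear. Qed.

Lemma rho_br x y : rho (br x y) = rho x *m rho y - rho y *m rho x.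
Proof. by case: rho_rep => _ ->. Qed.

Lemma rho_brE x y z : br x y = z -> rho x *m rho y = rho y *m rho x + rho z.
Proof. by move=> <-; rewrite rho_br addrC subrK. Qed.

Lemma rho_brZ a x y z : br x y = a *: z ->
  rho x *m rho y = rho y *m rho x + a *: rho z.
Proof. by move=> /rho_brE ->; rewrite rhoZ. Qed.

Lemma rho_intertwine_br (P : 'M[C]_7) x y l l' :
  rho x *m P = P *m mx7 C l -> rho y *m P = P *m mx7 C l' ->
  rho (br x y) *m P = P *m mx7 C (commutator l l').
Proof.
move=> xP yP; rewrite rho_br mx7_commutator mulmxBl mulmxBr.
by rewrite -!mulmxA xP yP !mulmxA xP yP.
Qed.

(** The kernel is an ideal of a simple Lie algebra. *)
Lemma rho_injective : rho <> (fun=> 0) -> forall x, rho x = 0 -> x = 0.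
Proof.
move=> rho_neq0; have [_ simple] := g_simple.
have [||U UE] := @vspace_of_pred _ _ (fun x : g => rho x = 0).
- exact: rho0.
- by move=> a x y x0 y0; rewrite rho_linear x0 y0 scaler0 addr0.
have [|U0|UT] := simple U.
- by move=> x u /UE u0; apply/UE; rewrite rho_br u0 mulmx0 mul0mx subrr.
- by move=> x /UE; rewrite U0 memv0 => /eqP.
by case: rho_neq0; apply/funext => x; apply/UE; rewrite UT memvf.
Qed.

(** Once the generators are in standard form, so are their iterated brackets. As [rho] is faithful,
    the structure constants are read off from the matrices, and they give the Killing form. *)
Lemma G2_standard_form : exists2 P : 'M[C]_7, P \in unitmx &
  exists b : 14.-tuple g,
    [/\ basis_of fullv b,
        forall a : 'I_14, rho b`_a *m P = P *m mx7 C (basis_tab a) &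
        forall a c : 'I_14,
          killing br b`_a b`_c = (entry killing_table a c)%:~R].
Proof.
have [e [f [hc [hh ef he serre gen]]]] := g_G2.
pose e0 := e 0; pose e1 := e 1; pose f0 := f 0; pose f1 := f 1.
pose h0 := hc 0; pose h1 := hc 1.
have heZ i j a : (cartan_G2 i j)%:~R = a ->
    br (hc i) (e j) = a *: e j /\ br (hc i) (f j) = (- a) *: f j.
  by move=> <-; have [-> ->] := he i j; rewrite scaleNr !scaler_int.
have [he00 hf00] := heZ 0 0 2%:R erefl.
have [he01 hf01] := heZ 0 1 (-1) erefl.
have [he10 hf10] := heZ 1 0 (- 3%:R) erefl.
have [he11 hf11] := heZ 1 1 2%:R erefl.
rewrite opprK in hf01; rewrite opprK in hf10.
(* Generation by the Chevalley generators, as an induction principle. *)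
have gen_ind (p : g -> Prop) : p 0 -> (forall a x y, p x -> p y -> p (a *: x + y)) ->
    (forall x y, p x -> p y -> p (br x y)) ->
    p e0 -> p e1 -> p f0 -> p f1 -> p h0 -> p h1 -> forall x, p x.
  move=> p0 pL pbr pe0 pe1 pf0 pf1 ph0 ph1 x.
  have [U UE] := vspace_of_pred p0 pL.
  apply/UE; suff -> : U = fullv by exact: memvf.
  apply: gen => [y z /UE py /UE pz|i]; first by apply/UE; exact: pbr.
  suff i01 : i = 0 \/ i = 1 by apply/and3P; split; apply/UE; case: i01 => ->.
  by case: i => -[|[|//]] ilt; [left | right]; exact: val_inj.
have irr m (M : 'M[C]_(7, m)) : M != 0 ->
    (forall x, x \in [:: rho e0; rho e1; rho f0; rho f1; rho h0; rho h1] ->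
      exists Y, x *m M = M *m Y) -> exists N, M *m N = 1%:M.
  move=> M0 xM; apply: invariant_span_full => // x; move: x.
  apply: gen_ind; try by apply: xM; rewrite !inE eqxx ?orbT.
  - by exists 0; rewrite rho0 mulmx0 mul0mx.
  - move=> a x y [Y xY] [Z yZ]; exists (a *: Y + Z).
    by rewrite rho_linear mulmxDl mulmxDr -scalemxAl xY yZ scalemxAr.
  - move=> x y [Y xY] [Z yZ]; exists (Y *m Z - Z *m Y).
    by rewrite rho_br mulmxBl mulmxBr -!mulmxA yZ xY !mulmxA xY yZ.
have rho_comm x y : br x y = 0 -> rho x *m rho y = rho y *m rho x.
  by move=> /rho_brE ->; rewrite rho0 addr0.
have [P Pu [e0P e1P f0P f1P]] := G2_standard_basis (rho_comm _ _ (hh 0 1))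
  (rho_brE (ef 0 0)) (rho_brE (ef 1 1)) (rho_comm _ _ (ef 0 1)) (rho_comm _ _ (ef 1 0))
  (rho_brZ he00) (rho_brZ he01) (rho_brZ he10) (rho_brZ he11)
  (rho_brZ hf00) (rho_brZ hf01) (rho_brZ hf10) (rho_brZ hf11) irr.
exists P => //.
have h0P : rho h0 *m P = P *m mx7 C tabH0.
  by rewrite /h0 -[hc 0](ef 0 0); exact: (@rho_intertwine_br P (e 0) (f 0) tabE0 tabF0).
have h1P : rho h1 *m P = P *m mx7 C tabH1.
  by rewrite /h1 -[hc 1](ef 1 1); exact: (@rho_intertwine_br P (e 1) (f 1) tabE1 tabF1).
pose b : 14.-tuple g := [tuple of lie_basis br e0 e1 f0 f1 h0 h1].
have bP (a : 'I_14) : rho b`_a *m P = P *m mx7 C (basis_tab a).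
  rewrite /basis_tab G2_tabsE.
  case: a => -[|[|[|[|[|[|[|[|[|[|[|[|[|[|//]]]]]]]]]]]]]] lt_a;
    do 5?[assumption | apply: rho_intertwine_br].
have rho_lin_sum (k : 'I_14 -> C) :
    rho (\sum_a k a *: b`_a) *m P = P *m \sum_a k a *: mx7 C (basis_tab a).
  rewrite (linear_sum_scale rho_linear) mulmx_suml mulmx_sumr; apply: eq_bigr => a _.
  by rewrite -scalemxAl bP scalemxAr.
have P_inj (X Y : 'M[C]_7) : X *m P = Y *m P -> X = Y.
  by move=> /(congr1 (mulmx^~ (invmx P))); rewrite !mulmxK.
have rho_inj x y : rho x = rho y -> x = y.
  move=> rho_xy; apply/subr0_eq; apply: rho_injective; last first.
    by rewrite addrC -scaleN1r rho_linear rho_xy scaleN1r addNr.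
  (* [rho] is nonzero because [tabE0] has the entry [1] in position [(1, 2)]. *)
  move=> rho0; have : mx7 C tabE0 1 (inord 2) = 0.
    suff -> : mx7 C tabE0 = 0 by rewrite mxE.
    by rewrite -[mx7 C tabE0](mulKmx Pu) -e0P rho0 mul0mx mulmx0.
  by rewrite mxE inordK // => /eqP; rewrite oner_eq0.
have brb (a c : 'I_14) : br b`_a b`_c = \sum_(k < 14) (lie_struct a c k)%:~R *: b`_k.
  apply/rho_inj/P_inj; rewrite rho_lin_sum -basis_tab_commutator.
  by rewrite rho_br mulmxBl mulmxBr -!mulmxA !bP !mulmxA !bP.
have b_free : free b.
  apply/freeP => k kb0 a.
  have kB : \sum_a k a *: mx7 C (basis_tab a) = 0.
    by rewrite -[LHS](mulKmx Pu) -rho_lin_sum kb0 rho0 mul0mx mulmx0.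
  (* The relation is orthogonal to every basis vector for the Killing form; pairing with the dual
     table then isolates [288 k a]. *)
  have kM (c : 'I_14) : \sum_(a < 14) k a * (entry killing_table a c)%:~R = 0.
    transitivity (4%:R * \tr ((\sum_a k a *: mx7 C (basis_tab a)) *m mx7 C (basis_tab c)));
      last by rewrite kB mul0mx mxtrace0 mulr0.
    rewrite mulmx_suml linear_sum mulr_sumr; apply: eq_bigr => i _.
    by rewrite -scalemxAl linearZ /= mulrCA mxtrace_basis_tab.
  have /eqP : \sum_(d < 14) k d * (\sum_(c < 14)
      (entry killing_table d c)%:~R * (entry dual_table c a)%:~R) = 0.
    under eq_bigr do rewrite mulr_sumr; rewrite exchange_big big1 // => c _.
    by under eq_bigr do rewrite mulrA; rewrite -mulr_suml kM mul0r.
  rewrite (bigD1 a) //= killing_dual eqxx mul1r big1 ?addr0; last first.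
    by move=> d da; rewrite killing_dual (negbTE da) mul0r mulr0.
  by rewrite mulf_eq0 pnatr_eq0 orbF => /eqP.
have b_mem (a : 'I_14) : b`_a \in <<b>>%VS by apply/memv_span/mem_nth; rewrite size_tuple.
have b_basis : basis_of fullv b.
  rewrite basisEfree b_free subvf size_tuple /=.
  suff -> : fullv = <<b>>%VS by rewrite -{2}(size_tuple b) dim_span.
  (* The span of [b] is a subalgebra by [brb], and it contains the generators. *)
  apply/esym/gen => [x y xb yb|i].
    rewrite (coord_span xb) (linear_sum_scale (br_linearl br_lie _)).
    apply: memv_suml => a _; apply: memvZ.
    rewrite (coord_span yb) (linear_sum_scale (br_linearr br_lie _)).
    apply: memv_suml => c _; apply: memvZ; rewrite brb.
    by apply: memv_suml => k _; apply/memvZ/b_mem.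
  suff i01 : i = 0 \/ i = 1.
    by apply/and3P; split; apply: memv_span; case: i01 => ->; rewrite !inE eqxx ?orbT.
  by case: i => -[|[|//]] ilt; [left | right]; exact: val_inj.
exists b; split=> // a c; rewrite (killing_basis br_lie _ _ b_basis) killing_tableE.
rewrite exchange_big.
apply: eq_bigr => l _; rewrite brb (linear_sum_scale (br_linearr br_lie _)) linear_sum.
apply: eq_bigr => k _; rewrite brb linearZ /= coord_sum_free // mulrC //.
Qed.
End G2Rep.

(** * Invariants of the tensor square *)

Lemma sum_mxtens (V : nmodType) m n (F : 'I_(m * n) -> V) :
  \sum_p F p = \sum_(i < m) \sum_(j < n) F (mxtens_index (i, j)).
Proof.
rewrite pair_bigA (reindex (@mxtens_index m n)) /=; last first.
  by exists (@mxtens_unindex m n) => p _; [exact: mxtens_indexK | exact: mxtens_unindexK].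
by apply: eq_bigr => -[i j].
Qed.

Section Slices.
Variables (K : comPzRingType) (n : nat).
Implicit Types (A : 'M[K]_(n * n, n)) (M N : 'M[K]_n).

(** A column of length [n * n] is a tensor; reading it as an [n] by [n] matrix [X] makes [M (x) N]
    act by [M X N^T] and the flip by transposition. *)
Definition slice p (A : 'M[K]_(n * n, p)) m : 'M[K]_n :=
  \matrix_(i, k) A (mxtens_index (i, k)) m.

Definition unslice p (Z : 'I_p -> 'M[K]_n) : 'M[K]_(n * n, p) :=
  \matrix_(x, m) Z m (mxtens_unindex x).1 (mxtens_unindex x).2.

Definition flip_mx : 'M[K]_(n * n) :=
  \matrix_(x, y) [&& (mxtens_unindex x).1 == (mxtens_unindex y).2
                   & (mxtens_unindex x).2 == (mxtens_unindex y).1]%:R.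

Lemma slice_inj p (A A' : 'M[K]_(n * n, p)) :
  (forall m, slice A m = slice A' m) -> A = A'.
Proof.
move=> AA'; apply/matrixP => x m; case: (mxtens_indexP x) => i k.
by have /matrixP/(_ i k) := AA' m; rewrite !mxE.
Qed.

Lemma unsliceK p (Z : 'I_p -> 'M[K]_n) m : slice (unslice Z) m = Z m.
Proof. by apply/matrixP => i k; rewrite !mxE mxtens_indexK. Qed.

Lemma slice_tens p (A : 'M[K]_(n * n, p)) M N m :
  slice ((M *t N) *m A) m = M *m slice A m *m N^T.
Proof.
apply/matrixP => i k; rewrite !mxE sum_mxtens exchange_big.
apply: eq_bigr => l _; rewrite !mxE mulr_suml; apply: eq_bigr => j _.
by rewrite !mxE !mxtens_indexK /=; ring.
Qed.

Lemma slice_mul p q (A : 'M[K]_(n * n, p)) (S : 'M[K]_(p, q)) m :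
  slice (A *m S) m = \sum_j S j m *: slice A j.
Proof.
apply/matrixP => i k; rewrite !mxE summxE; apply: eq_bigr => j _.
by rewrite !mxE mulrC.
Qed.

Lemma slice_flip p (A : 'M[K]_(n * n, p)) m :
  slice (flip_mx *m A) m = (slice A m)^T.
Proof.
apply/matrixP => i k; rewrite !mxE (bigD1 (mxtens_index (k, i))) //=.
rewrite mxE !mxtens_indexK !eqxx mul1r big1 ?addr0 // => x.
case: (mxtens_indexP x) => j l; rewrite mxE !mxtens_indexK /= => ne.
case: eqP => [il|]; case: eqP => [kj|]; rewrite ?mul0r //.
by rewrite il kj eqxx in ne.
Qed.

Lemma sliceD p (A A' : 'M[K]_(n * n, p)) m : slice (A + A') m = slice A m + slice A' m.
Proof. by apply/matrixP => i k; rewrite !mxE. Qed.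

Lemma sliceZ p a (A : 'M[K]_(n * n, p)) m : slice (a *: A) m = a *: slice A m.
Proof. by apply/matrixP => i k; rewrite !mxE. Qed.

Lemma slice0 p m : slice (0 : 'M[K]_(n * n, p)) m = 0.
Proof. by apply/matrixP => i k; rewrite !mxE. Qed.

Lemma trmx_flip : flip_mx^T = flip_mx.
Proof. by apply/matrixP => x y; rewrite !mxE andbC eq_sym [X in _ && X]eq_sym. Qed.

(** The action of a Lie algebra element on the tensor square. *)
Definition coproduct M := M *t 1%:M + 1%:M *t M.

Lemma slice_coproduct p (A : 'M[K]_(n * n, p)) M m :
  slice (coproduct M *m A) m = M *m slice A m + slice A m *m M^T.
Proof. by rewrite mulmxDl sliceD !slice_tens trmx1 mul1mx mulmx1. Qed.

Lemma trmx_coproduct M : (coproduct M)^T = coproduct M^T.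
Proof. by rewrite /coproduct linearD /= !trmx_tens !trmx1. Qed.

End Slices.

(** * Equivariant maps in the standard basis *)

Section Standard.
Variable C : numClosedFieldType.
Local Notation B a := (mx7 C (basis_tab a)).
Local Notation J := (mx7 C form_tab).
Hypothesis irr : forall m (M : 'M[C]_(7, m)), M != 0 ->
  (forall a : 'I_14, exists Y, B a *m M = M *m Y) -> exists N, M *m N = 1%:M.

(** The kernel of [D] is stable and contains [u], so it is the whole space; the columns of [M] span
    it. *)
Lemma intertwiner_eq0 n (D : 'M[C]_(n, 7)) (u : 'cV[C]_7) :
  (forall a : 'I_14, exists S, D *m B a = S *m D) -> u != 0 -> D *m u = 0 -> D = 0.
Proof.
move=> DB u0 Du; pose M := (kermx D^T)^T.
have DM : D *m M = 0 by apply: trmx_inj; rewrite trmx_mul trmxK mulmx_ker trmx0.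
have kerM m (X : 'M[C]_(7, m)) : D *m X = 0 -> exists Y, X = M *m Y.
  move=> DX; have /submxP[Y XY] : (X^T <= kermx D^T)%MS.
    by apply/sub_kermxP; rewrite -trmx_mul DX trmx0.
  by exists Y^T; rewrite -trmx_mul -XY trmxK.
have [||N MN] := irr (M := M).
- by have [y uy] := kerM _ _ Du; apply: contraNneq u0 => M0; rewrite uy M0 mul0mx.
- by move=> a; apply: kerM; have [S DS] := DB a; rewrite mulmxA DS -mulmxA DM mulmx0.
by rewrite -[D]mulmx1 -MN mulmxA DM mul0mx.
Qed.

(** If [c] is an eigenvalue, [M - c] commutes with the action and kills a nonzero vector. *)
Lemma schur (M : 'M[C]_7) : (forall a : 'I_14, M *m B a = B a *m M) ->
  exists c, M = c%:M.
Proof.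
move=> MB; have [//|c /eigenvalueP[v vM v0]] := eigenvalue_closed M^T _.
exists c; apply/subr0_eq/(@intertwiner_eq0 _ _ v^T); last 2 first.
- by rewrite trmx_eq0.
- apply: trmx_inj; rewrite trmx_mul trmxK linearB /= tr_scalar_mx mulmxBr.
  by rewrite vM mul_mx_scalar subrr trmx0.
by move=> a; exists (B a); rewrite mulmxBl mulmxBr MB scalar_mxC.
Qed.

Definition form_vec : 'M[C]_(7 * 7, 1) := unslice (fun=> J).
Definition cross_mx : 'M[C]_(7 * 7, 7) := unslice (fun m : 'I_7 => mx7 C (cross_tab m)).
Definition cocross_mx : 'M[C]_(7 * 7, 7) := unslice (fun m : 'I_7 => mx7 C (cocross_tab m)).

Let BJ (a : 'I_14) : B a *m J = - (J *m (B a)^T).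
Proof. by apply/eqP; rewrite -addr_eq0 form_tab_invariant. Qed.

Let JB (a : 'I_14) : J *m B a = - ((B a)^T *m J).
Proof.
have := congr1 (fun X => J *m X *m J) (BJ a).
by rewrite mulmxN mulNmx -!mulmxA form_tab_sqr mulmx1 (mulmxA J J) form_tab_sqr mul1mx.
Qed.

(** For an invariant tensor [X] the matrix [X J] commutes with the action, so it is a scalar [x],
    and [X = x J] because [J^2 = 1]. *)
Lemma invariant_vector (iC : 'M[C]_(7 * 7, 1)) :
  (forall a : 'I_14, coproduct (B a) *m iC = 0) -> exists x, iC = x *: form_vec.
Proof.
move=> inv; have BX (a : 'I_14) : B a *m slice iC 0 = - (slice iC 0 *m (B a)^T).
  by apply/eqP; rewrite -addr_eq0 -slice_coproduct inv slice0.
have [a|x XJ] := schur (M := slice iC 0 *m J).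
  by rewrite mulmxA BX mulNmx -!mulmxA JB mulmxN.
exists x; apply: slice_inj => m; rewrite ord1 sliceZ unsliceK.
by rewrite -[LHS]mulmx1 -(form_tab_sqr C) mulmxA XJ mul_scalar_mx.
Qed.

Lemma invariant_covector (pC : 'M[C]_(1, 7 * 7)) :
  (forall a : 'I_14, pC *m coproduct (B a) = 0) -> exists x, pC = x *: form_vec^T.
Proof.
move=> inv; pose Y := slice pC^T 0.
have BY (a : 'I_14) : (B a)^T *m Y = - (Y *m B a).
  apply/eqP; rewrite -addr_eq0 -{2}(trmxK (B a)) -slice_coproduct.
  by rewrite -trmx_coproduct -trmx_mul inv trmx0 slice0.
have [a|x JY] := schur (M := J *m Y).
  by rewrite mulmxA BJ mulNmx -!mulmxA BY mulmxN opprK.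
exists x; apply: trmx_inj; rewrite linearZ /= trmxK.
apply: slice_inj => m; rewrite ord1 sliceZ unsliceK -/Y.
by rewrite -[LHS]mul1mx -(form_tab_sqr C) -mulmxA JY mul_mx_scalar.
Qed.

Lemma sum_inord (F : 'I_7 -> C) : \sum_i F i = F (inord 0) + (F (inord 1) +
  (F (inord 2) + (F (inord 3) + (F (inord 4) + (F (inord 5) + F (inord 6)))))).
Proof.
have -> : \sum_i F i = \sum_(0 <= i < 7) F (inord i).
  by rewrite big_mkord; apply: eq_bigr => i _; rewrite inord_val.
by rewrite unlock /= addr0.
Qed.

Lemma mx7_inord l i j : (i < 7)%N -> (j < 7)%N ->
  mx7 C l (inord i) (inord j) = (entry l i j)%:~R.
Proof. by move=> i7 j7; rewrite mxE !inordK. Qed.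

(* The highest weight vectors of weight (0, 1) in the tensor square form a line. *)
Lemma highest_weight_slice (A : 'M[C]_7) :
  B 0 *m A + A *m (B 0)^T = 0 -> B 1 *m A + A *m (B 1)^T = 0 ->
  B 12 *m A + A *m (B 12)^T = 0 -> B 13 *m A + A *m (B 13)^T = A ->
  exists z, A = z *: mx7 C (cross_tab 0).
Proof.
move=> e0A e1A h0A h1A.
have diagA a (i k : 'I_7) : (a == 12%N) || (a == 13%N) ->
    (B a *m A + A *m (B a)^T) i k =
      (entry (basis_tab a) i i + entry (basis_tab a) k k)%:~R * A i k.
  move=> a1213; have diag (i' j : 'I_7) : i' != j -> entry (basis_tab a) i' j = 0.
    have : all (fun i => all (fun j => (i != j) ==> (entry (basis_tab a) i j == 0))
      (iota 0 7)) (iota 0 7) by case/orP: a1213 => /eqP ->; vm_compute.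
    by move=> /all_iota0/(_ i')/all_iota0/(_ j)/implyP E ij; apply/eqP/E.
  rewrite !mxE (bigD1 i) // [X in _ + X = _](bigD1 k) //= !mxE.
  rewrite [X in _ + X + _]big1 => [|j ji]; last by rewrite mxE diag 1?eq_sym ?mul0r.
  rewrite [X in _ + (_ + X)]big1 => [|j jk]; last by rewrite !mxE diag 1?eq_sym ?mulr0.
  by rewrite !addr0 [A i k * _]mulrC -mulrDl -rmorphD.
(* [h0] and [h1] are diagonal, and only the positions with [i + k = 3] have total weight
   [(0, 1)]. *)
have A0 (i k : 'I_7) : (i + k != 3)%N -> A i k = 0.
  have : all (fun i => all (fun k => (i + k != 3)%N ==>
      ((entry (basis_tab 12) i i + entry (basis_tab 12) k k != 0) ||
       (entry (basis_tab 13) i i + entry (basis_tab 13) k k != 1))) (iota 0 7)) (iota 0 7).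
    by vm_compute.
  move=> /all_iota0/(_ i)/all_iota0/(_ k)/implyP E /E/orP[w|w].
    have := diagA 12%N i k isT; rewrite h0A mxE => /esym/eqP.
    by rewrite mulf_eq0 intr_eq0 (negbTE w) => /eqP.
  have /eqP := diagA 13%N i k isT; rewrite h1A -subr_eq0 -{1}[A i k]mul1r -mulrBl.
  have -> (c : int) : 1 - c%:~R = (1 - c)%:~R :> C by rewrite rmorphB.
  by rewrite mulf_eq0 intr_eq0 subr_eq0 eq_sym (negbTE w) => /eqP.
(* Three entries of the equations for [e0] and [e1] determine the antidiagonal [i + k = 3] up to a
   factor, in the ratio [-1 : 2 : -2 : 1]. *)
have := congr1 (fun X : 'M[C]_7 => X (inord 0) (inord 2)) e1A.
have := congr1 (fun X : 'M[C]_7 => X (inord 2) (inord 0)) e1A.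
have := congr1 (fun X : 'M[C]_7 => X (inord 1) (inord 1)) e0A.
rewrite !mxE !sum_inord ![_^T _ _]mxE !mx7_inord // /entry /basis_tab /=.
rewrite !(mul0r, mulr0, mul1r, mulr1, add0r, addr0) => a21_a12 a30_a21 a12_a03.
have a21 : A (inord 2) (inord 1) = - 2%:R * A (inord 3) (inord 0).
  by apply/eqP; rewrite mulNr -addr_eq0 addrC a30_a21.
have a12 : A (inord 1) (inord 2) = 2%:R * A (inord 3) (inord 0).
  by apply/eqP; rewrite -subr_eq0 -mulNr -a21 addrC a21_a12.
have a03 : A (inord 0) (inord 3) = - A (inord 3) (inord 0).
  apply/eqP; rewrite -addr_eq0 -(mulIr_eq0 _ (mulIf (_ : 2%:R != 0))) ?pnatr_eq0 //.
  by rewrite mulrDl addrC [A (inord 3) _ * _]mulrC -a12 a12_a03.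
exists (A (inord 3) (inord 0)); apply/matrixP => i k; rewrite !mxE.
have [ik|ik] := eqVneq (i + k)%N 3; last first.
  rewrite A0 //.
  have : all (fun i => all (fun k => (i + k != 3)%N ==> (entry (cross_tab 0) i k == 0))
    (iota 0 7)) (iota 0 7) by vm_compute.
  move=> /all_iota0/(_ i)/all_iota0/(_ k)/implyP/(_ ik)/eqP ->; exact/esym/mulr0.
pose n := nat_of_ord i; have Di : i = inord n by rewrite inord_val.
have Dk : k = inord (3 - n) by apply: val_inj; rewrite /= inordK; lia.
have n4 : (n < 4)%N by rewrite /n; lia.
rewrite Di Dk; case: n n4 {Di Dk} => [|[|[|[|//]]]] _; rewrite !inordK //.
- by rewrite a03 mulrN1.
- by rewrite a12 mulrC.
- by rewrite a21 mulrC.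
- by rewrite mulr1.
Qed.

Lemma cross_mx_equivariant (a : 'I_14) : coproduct (B a) *m cross_mx = cross_mx *m B a.
Proof.
apply: slice_inj => m; rewrite slice_coproduct unsliceK cross_tab_equivariant slice_mul.
by apply: eq_bigr => j _; rewrite unsliceK.
Qed.

(* The difference of two embeddings that agree on the highest weight vector has
   a nonzero invariant kernel. *)
Lemma equivariant_embedding (iV : 'M[C]_(7 * 7, 7)) :
  (forall a : 'I_14, coproduct (B a) *m iV = iV *m B a) -> exists z, iV = z *: cross_mx.
Proof.
move=> iVB; pose A := slice iV 0.
have BA (a : 'I_14) : B a *m A + A *m (B a)^T = \sum_j B a j 0 *: slice iV j.
  by rewrite -slice_coproduct iVB slice_mul.
(* The first basis vector is killed by [e0], [e1], [h0] and fixed by [h1]; its image [A] inherits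
   these equations. *)
have col0 a (c : int) : (a < 14)%N ->
    all (fun j => entry (basis_tab a) j 0 == (if j == 0%N then c else 0)) (iota 0 7) ->
    B a *m A + A *m (B a)^T = c%:~R *: A.
  move=> a14 /all_iota0 B0; rewrite (BA (Ordinal a14)) (bigD1 ord0) //= big1 ?addr0.
    by rewrite mxE (eqP (B0 ord0)).
  by move=> j j0; rewrite mxE (eqP (B0 j)) -[(_ == _)%N]/(j == ord0) (negbTE j0) scale0r.
have [|||| z Az] := @highest_weight_slice A.
- by rewrite (col0 _ 0) ?scale0r.
- by rewrite (col0 _ 0) ?scale0r.
- by rewrite (col0 _ 0) ?scale0r.
- by rewrite (col0 _ 1) ?scale1r.
exists z; apply/subr0_eq/(@intertwiner_eq0 _ _ (delta_mx 0 0)).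
- move=> a; exists (coproduct (B a)).
  by rewrite mulmxBl mulmxBr iVB -scalemxAl -cross_mx_equivariant -scalemxAr.
- by apply/eqP => /matrixP/(_ 0 0)/eqP; rewrite !mxE oner_eq0.
rewrite -colE; apply/matrixP => x y; rewrite !mxE; case: (mxtens_indexP x) => i k.
have /matrixP/(_ i k) := Az; rewrite !mxE => ->; rewrite mxtens_indexK.
by rewrite subrr.
Qed.

Lemma form_coproduct (a : 'I_14) :
  coproduct (B a) *m (J *t J) = - ((J *t J) *m coproduct (B a)^T).
Proof.
rewrite mulmxDl mulmxDr !tensmx_mul !mul1mx !mulmx1 BJ.
by apply/matrixP => x y; rewrite !mxE mulNr mulrN opprD.
Qed.

(* The invariant form turns the transpose of a projection into an embedding. *)
Lemma equivariant_projection (pV : 'M[C]_(7, 7 * 7)) :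
  (forall a : 'I_14, pV *m coproduct (B a) = B a *m pV) -> exists w, pV = w *: cocross_mx^T.
Proof.
move=> pVB; pose A := (J *t J) *m pV^T *m J.
have [|w Aw] := @equivariant_embedding A.
  move=> a; rewrite !mulmxA form_coproduct !mulNmx -(mulmxA (J *t J)).
  rewrite -trmx_coproduct -trmx_mul pVB trmx_mul -!mulmxA JB !mulmxN.
  by rewrite !mulmxA.
have JJ : (J *t J) *m (J *t J) = 1%:M.
  rewrite tensmx_mul form_tab_sqr; apply: slice_inj => m.
  by rewrite -[_ *t _]mulmx1 slice_tens trmx1 mul1mx mulmx1.
exists w; apply: trmx_inj; rewrite linearZ /= trmxK.
have -> : pV^T = (J *t J) *m A *m J.
  by rewrite !mulmxA JJ mul1mx -mulmxA form_tab_sqr mulmx1.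
rewrite Aw -scalemxAr -scalemxAl; congr (_ *: _); apply: slice_inj => m.
rewrite -mulmxA slice_tens slice_mul form_tab_sym unsliceK cocross_tabE; congr (_ *m _ *m _).
by apply: eq_bigr => j _; rewrite unsliceK.
Qed.

Lemma casimir_standard :
  \sum_(a < 14) \sum_(b < 14) (entry dual_table a b)%:~R *: (B a *t B b) =
  12%:R *: (1%:M + flip_mx C 7) - 24%:R *: (form_vec *m form_vec^T)
  - 12%:R *: (cross_mx *m cocross_mx^T).
Proof.
apply/matrixP => x y; case: (mxtens_indexP x) => i k; case: (mxtens_indexP y) => j l.
have := @casimir_entries C i j k l => E.
rewrite summxE; under eq_bigr => a _.
  rewrite summxE; under eq_bigr => b _ do rewrite mxE tensmxE; over.
rewrite E !mxE big_ord1 !mxE !mxtens_indexK /= (can_eq (@mxtens_indexK 7 7)) xpair_eqE.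
rewrite mulrDr; congr (_ - _ - _ * _).
by apply: eq_bigr => m _; rewrite !mxE !mxtens_indexK.
Qed.

Lemma form_vec_norm : form_vec^T *m form_vec = 7%:R%:M.
Proof.
have /(congr1 mxtrace) := form_tab_sqr C; rewrite mxtrace1 => E.
apply/matrixP => i j; rewrite !ord1 !mxE sum_mxtens -E mulr1n.
apply: eq_bigr => k _; rewrite mxE; apply: eq_bigr => l _.
have /matrixP/(_ k l) := form_tab_sym C; rewrite !mxE !mxtens_indexK => -> //.
Qed.

Lemma cocross_mx_cross_mx : cocross_mx^T *m cross_mx = 6%:R%:M.
Proof.
apply/matrixP => i j; rewrite !mxE sum_mxtens -(mulr_natr 6%:R) -(cocross_cross_dual C i j).
by apply: eq_bigr => k _; apply: eq_bigr => l _; rewrite !mxE !mxtens_indexK.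
Qed.

Lemma flip_form_vec : flip_mx C 7 *m form_vec = form_vec.
Proof. by apply: slice_inj => m; rewrite slice_flip unsliceK form_tab_sym. Qed.

Lemma flip_cross_mx : flip_mx C 7 *m cross_mx = - cross_mx.
Proof.
apply: slice_inj => m.
by rewrite slice_flip -scaleN1r sliceZ unsliceK cross_tab_antisym scaleN1r.
Qed.

Lemma flip_cocross_mx : flip_mx C 7 *m cocross_mx = - cocross_mx.
Proof.
apply: slice_inj => m; rewrite slice_flip -scaleN1r sliceZ unsliceK cocross_tabE.
rewrite !trmx_mul form_tab_sym linear_sum /= scaleN1r -mulNmx -mulmxN mulmxA -sumrN.
congr (_ *m _ *m _); apply: eq_bigr => n _.
by rewrite linearZ /= cross_tab_antisym scalerN.
Qed.

End Standard.

Lemma tensmx_linearl (K : comPzRingType) m n p q (Y : 'M[K]_(p, q)) :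
  linear (fun X : 'M[K]_(m, n) => X *t Y).
Proof. by move=> a X X'; apply/matrixP => x y; rewrite !mxE mulrDl mulrA. Qed.

Lemma tensmx_linearr (K : comPzRingType) m n p q (X : 'M[K]_(m, n)) :
  linear (fun Y : 'M[K]_(p, q) => X *t Y).
Proof. by move=> a Y Y'; apply/matrixP => x y; rewrite !mxE mulrDr mulrCA. Qed.

Lemma flip_tens (K : comPzRingType) n (M : 'M[K]_n) :
  flip_mx K n *m (M *t M) = (M *t M) *m flip_mx K n.
Proof.
apply: slice_inj => m; rewrite slice_flip slice_tens.
rewrite -[M *t M]mulmx1 slice_tens !trmx_mul trmxK mulmxA; congr (_ *m _ *m _).
by rewrite -slice_flip mulmx1.
Qed.

(** * The Casimir formula on the tensor square *)

Section TensorSquare.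
Variables (C : numClosedFieldType) (g : vectType C) (br : g -> g -> g).
Variables (rho : g -> 'M[C]_7) (h : C).
Hypotheses (br_lie : is_lie_bracket br) (g_simple : lie_simple br).
Hypotheses (g_G2 : lie_type_G2 br) (rho_rep : is_lie_rep br rho).
Hypotheses (rho_irr : lie_irreducible rho) (h_neq0 : h != 0).

Definition casimir_square : 'M[C]_(7 * 7) :=
  let bs := vbasis {:g} in
  let gram : 'M[C]_(\dim {:g}) := \matrix_(i, j) (h * killing br bs`_i bs`_j) in
  \sum_i \sum_j invmx gram i j *: (rho bs`_i *t rho bs`_j).

Variables (iC : 'M[C]_(7 * 7, 1)) (pC : 'M[C]_(1, 7 * 7)).
Variables (iV : 'M[C]_(7 * 7, 7)) (pV : 'M[C]_(7, 7 * 7)).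
Hypothesis iC_equiv : forall x, coproduct (rho x) *m iC = 0.
Hypothesis pC_equiv : forall x, pC *m coproduct (rho x) = 0.
Hypothesis iV_equiv : forall x, coproduct (rho x) *m iV = iV *m rho x.
Hypothesis pV_equiv : forall x, pV *m coproduct (rho x) = rho x *m pV.
Hypothesis pC_iC : pC *m iC = 1%:M.
Hypothesis pV_iV : pV *m iV = 1%:M.

(** After the change of basis [P], each of the four maps is a multiple of a standard one. Only the
    products [y x = 1/7] and [w z = 1/6] of the factors matter, and the conditions [pC iC = 1] and
    [pV iV = 1] fix them. *)
Lemma tensor_square_casimir :
  [/\ (24%:R * h) *: casimir_square =
        1%:M + flip_mx C 7 - 14%:R *: (iC *m pC) - 6%:R *: (iV *m pV),
      flip_mx C 7 *m iC = iC /\ pC *m flip_mx C 7 = pC &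
      flip_mx C 7 *m iV = - iV /\ pV *m flip_mx C 7 = - pV].
Proof.
have [P Pu [b [b_basis rhoP killingE]]] :=
  G2_standard_form br_lie g_simple g_G2 rho_rep rho_irr.
pose Q := P *t P; pose Qi := invmx P *t invmx P.
have tens1 : (1%:M : 'M[C]_7) *t (1%:M : 'M[C]_7) = 1%:M.
  by apply: slice_inj => m; rewrite -[_ *t _]mulmx1 slice_tens trmx1 mul1mx mulmx1.
have QQi : Q *m Qi = 1%:M by rewrite tensmx_mul !mulmxV.
have QiQ : Qi *m Q = 1%:M by rewrite tensmx_mul !mulVmx.
have flipQ : flip_mx C 7 *m Q = Q *m flip_mx C 7 by exact: flip_tens.
have flipQi : flip_mx C 7 *m Qi = Qi *m flip_mx C 7 by exact: flip_tens.
have coQ (a : 'I_14) : coproduct (rho b`_a) *m Q = Q *m coproduct (mx7 C (basis_tab a)).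
  by rewrite mulmxDl mulmxDr !tensmx_mul !mul1mx !mulmx1 rhoP.
have coQi (a : 'I_14) : Qi *m coproduct (rho b`_a) = coproduct (mx7 C (basis_tab a)) *m Qi.
  by rewrite -[LHS]mulmx1 -QQi mulmxA -(mulmxA Qi) coQ mulmxA QiQ mul1mx.
have irr m (M : 'M[C]_(7, m)) : M != 0 ->
    (forall a : 'I_14, exists Y, mx7 C (basis_tab a) *m M = M *m Y) -> exists N, M *m N = 1%:M.
  move=> M0 /choice[Y BY]; have [||N PMN] := @invariant_span_full _ _ _ rho_irr _ (P *m M).
  - by apply: contraNneq M0 => PM0; rewrite -[M](mulKmx Pu) PM0 mulmx0.
  - move=> x; exists (\sum_a coord b a x *: Y a).
    rewrite {1}(coord_basis b_basis (memvf x)) (linear_sum_scale (rho_linear rho_rep)).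
    rewrite mulmx_suml mulmx_sumr; apply: eq_bigr => a _.
    by rewrite -scalemxAl mulmxA rhoP -!mulmxA BY -!scalemxAr.
  exists (N *m P); rewrite mulmxA -[M *m N](mulKmx Pu).
  by rewrite [P *m (M *m N)]mulmxA PMN mulmx1 mulVmx.
have [a|x iCx] := @invariant_vector _ irr (Qi *m iC).
  by rewrite mulmxA -coQi -mulmxA iC_equiv mulmx0.
have [a|y pCy] := @invariant_covector _ irr (pC *m Q).
  by rewrite -mulmxA -coQ mulmxA pC_equiv mul0mx.
have [a|z iVz] := @equivariant_embedding _ irr (Qi *m iV *m P).
  by rewrite !mulmxA -coQi -(mulmxA Qi (coproduct _)) iV_equiv -!mulmxA rhoP !mulmxA.
have [a|w pVw] := @equivariant_projection _ irr (invmx P *m pV *m Q).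
  rewrite -!mulmxA -coQ (mulmxA pV) pV_equiv !mulmxA; congr (_ *m _ *m _).
  by rewrite -[rho _](mulmxK Pu) rhoP -mulmxA mulKmx.
have {iCx} iCE : iC = x *: (Q *m form_vec C).
  by rewrite scalemxAr -iCx mulmxA QQi mul1mx.
have {pCy} pCE : pC = y *: ((form_vec C)^T *m Qi).
  by rewrite scalemxAl -pCy -mulmxA QQi mulmx1.
have {iVz} iVE : iV = z *: (Q *m cross_mx C *m invmx P).
  by rewrite scalemxAl scalemxAr -iVz !mulmxA QQi mul1mx mulmxK.
have {pVw} pVE : pV = w *: (P *m (cocross_mx C)^T *m Qi).
  by rewrite scalemxAl scalemxAr -pVw !mulmxA mulmxV // mul1mx -mulmxA QQi mulmx1.
have xy : y * x * 7%:R = 1.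
  have /matrixP/(_ 0 0) := pC_iC; rewrite pCE iCE -scalemxAl -scalemxAr scalerA.
  by rewrite -mulmxA (mulmxA Qi) QiQ mul1mx form_vec_norm !mxE.
have zw : w * z * 6%:R = 1.
  have /matrixP/(_ 0 0) := pV_iV; rewrite pVE iVE -scalemxAl -scalemxAr scalerA.
  rewrite -!mulmxA (mulmxA Qi) QiQ mul1mx (mulmxA _ (cross_mx C)) cocross_mx_cross_mx.
  by rewrite mul_scalar_mx -scalemxAr mulmxV // !mxE mulr1n mulr1.
split; last 2 first.
- rewrite iCE pCE -scalemxAr mulmxA flipQ -mulmxA flip_form_vec; split=> //.
  rewrite -scalemxAl -mulmxA -flipQi mulmxA; congr (_ *: (_ *m _)).
  by apply: trmx_inj; rewrite trmx_mul trmx_flip trmxK flip_form_vec.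
- rewrite iVE pVE -scalemxAr !mulmxA flipQ -(mulmxA Q (flip_mx C 7)) flip_cross_mx; split.
    by rewrite mulmxN mulNmx scalerN.
  rewrite -scalemxAl -mulmxA -flipQi mulmxA -(mulmxA P).
  have -> : (cocross_mx C)^T *m flip_mx C 7 = - (cocross_mx C)^T.
    by apply: trmx_inj; rewrite trmx_mul trmx_flip trmxK flip_cocross_mx linearN /= trmxK.
  by rewrite mulmxN mulNmx scalerN.
have h288 : 288%:R * h != 0 by rewrite mulf_neq0 ?pnatr_eq0.
(* The inverse Gram matrix of the form [h kappa] in the basis [b]; multiplied by [24 h] it leaves
   the factor [1/12] before the dual table. *)
pose N : 'M[C]_14 := \matrix_(a, c) ((288%:R * h)^-1 * (entry dual_table a c)%:~R).
rewrite /casimir_square (casimir_tensor_basis br_lie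
  (t := fun x y => rho x *t rho y) (N := N) _ _ b_basis).
- transitivity (12%:R^-1 *: (Q *m (\sum_(a < 14) \sum_(c < 14)
      (entry dual_table a c)%:~R *: (mx7 C (basis_tab a) *t mx7 C (basis_tab c))) *m Qi)).
    rewrite mulmx_sumr mulmx_suml !scaler_sumr; apply: eq_bigr => a _.
    rewrite mulmx_sumr mulmx_suml !scaler_sumr; apply: eq_bigr => c _.
    rewrite -scalemxAr -scalemxAl !scalerA mxE tensmx_mul -!rhoP -tensmx_mul.
    rewrite -mulmxA QQi mulmx1; congr (_ *: _); field; rewrite h_neq0 //.
  rewrite casimir_standard iCE pCE iVE pVE.
  rewrite !mulmxBr !mulmxBl -!scalemxAr -!scalemxAl !scalerBr !scalerA.
  rewrite mulVf ?pnatr_eq0 // !scale1r mulmxDr mulmx1 mulmxDl QQi.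
  rewrite -flipQ -(mulmxA (flip_mx C 7)) QQi mulmx1.
  congr (_ - _ - _).
    rewrite !mulmxA; congr (_ *: _).
    by rewrite -[LHS]mulr1 -[X in _ * X = _]xy; field.
  rewrite -!mulmxA (mulKmx Pu) !mulmxA -[LHS]scale1r.
  by congr (_ *: _); rewrite -[LHS]zw; ring.
- by move=> y' a u v /=; rewrite (rho_linear rho_rep) tensmx_linearl.
- by move=> x' a u v /=; rewrite (rho_linear rho_rep) tensmx_linearr.
apply/matrixP => a c; rewrite !mxE.
transitivity ((288%:R)^-1 * (\sum_(k < 14)
  (entry killing_table a k)%:~R * (entry dual_table k c)%:~R) : C).
  rewrite mulr_sumr; apply: eq_bigr => k _; rewrite !mxE killingE; field; rewrite h_neq0 //.
by rewrite killing_dual mulrC mulfK ?pnatr_eq0.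
Qed.

End TensorSquare.

(** * Exponentials of power series and of matrices *)

Section PowerSeries.
Variable K : fieldType.
Implicit Types (f : fps K) (a b : K).

Lemma coefs_sum (I : Type) (r : seq I) (F : I -> fps K) n :
  coefs (\sum_(i <- r) F i) n = \sum_(i <- r) coefs (F i) n.
Proof. by elim/big_rec2: _ => //= i x y _ <-. Qed.

Lemma coefs_CM a f n : coefs (fpsC a * f) n = a * coefs f n.
Proof.
rewrite /= big_ord_recl /= mulr1n subn0 big1 ?addr0 // => i _.
by rewrite mulr0n mul0r.
Qed.

Lemma coefs_MX f n : coefs (fpsX K * f) n = if n is m.+1 then coefs f m else 0.
Proof.
case: n => [|n] /=; first by rewrite big_ord1 mul0r.
rewrite !big_ord_recl /= mul0r add0r mul1r subSS subn0 big1 ?addr0 // => i _.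
by rewrite mul0r.
Qed.

Fact fpsC_additive : zmod_morphism (@fpsC K).
Proof. by move=> a b; apply: fpsP => n /=; rewrite mulrnBl. Qed.

Fact fpsC_multiplicative : monoid_morphism (@fpsC K).
Proof.
by split=> [|a b]; apply: fpsP => n //; rewrite coefs_CM /= mulrnAr.
Qed.

HB.instance Definition _ :=
  GRing.isZmodMorphism.Build K (fps K) (@fpsC K) fpsC_additive.
HB.instance Definition _ :=
  GRing.isMonoidMorphism.Build K (fps K) (@fpsC K) fpsC_multiplicative.

Lemma fpsCX a k : fpsC a ^+ k = fpsC (a ^+ k).
Proof. by rewrite rmorphXn. Qed.

Lemma fpsC_nat n : fpsC n%:R = n%:R :> fps K.
Proof. exact: rmorph_nat. Qed.

Lemma fpsCM a b : fpsC (a * b) = fpsC a * fpsC b.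
Proof. exact: rmorphM. Qed.

Lemma fpsMZ m n a (A : 'M[K]_(m, n)) : fpsM (a *: A) = fpsC a *: fpsM A.
Proof. exact: map_mxZ. Qed.

Lemma fpsM_mul m n p (A : 'M[K]_(m, n)) (B : 'M[K]_(n, p)) :
  fpsM (A *m B) = fpsM A *m fpsM B.
Proof. exact: map_mxM. Qed.

Lemma coefs_Xn m n : coefs (fpsX K ^+ m) n = (n == m)%:R.
Proof.
elim: m n => [|m IHm] n; first by rewrite expr0.
by rewrite exprS coefs_MX; case: n => // n; rewrite IHm.
Qed.

(** Applying [(f M)^k] to [1 = sum_i P_i] gives [f^k sum_i l_i^k P_i], and the exponential series
    splits accordingly. *)
Lemma mx_exp_eigen N (M : 'M[K]_N) (I : finType) (P : I -> 'M[K]_N) (l : I -> K) f :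
  \sum_i P i = 1%:M -> (forall i, M *m P i = l i *: P i) ->
  mx_exp (f *: fpsM M) = \sum_i fps_exp (fpsC (l i) * f) *: fpsM (P i).
Proof.
move=> P1 MP.
have powE k : (f *: fpsM M) ^+ k = f ^+ k *: fpsM (\sum_i l i ^+ k *: P i).
  elim: k => [|k IHk].
    under eq_bigr do rewrite expr0 scale1r.
    by rewrite expr0 P1 map_mx1 expr0 scale1r.
  rewrite exprS IHk.
  transitivity ((f *: fpsM M) *m (f ^+ k *: fpsM (\sum_i l i ^+ k *: P i))) => //.
  rewrite -scalemxAl -scalemxAr scalerA -exprS -map_mxM mulmx_sumr.
  by under eq_bigr do rewrite -scalemxAr MP scalerA -exprSr.
have coefE e (S : 'M[K]_N) r c n : coefs ((e *: fpsM S) r c) n = S r c * coefs e n.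
  by rewrite !mxE mulrC coefs_CM.
apply/matrixP => r c; apply: fpsP => n; rewrite mxE summxE coefs_sum [LHS]/=.
under eq_bigr do rewrite powE coefE summxE !mulr_suml.
rewrite exchange_big; apply: eq_bigr => i _ /=.
rewrite coefE /= mulr_sumr; apply: eq_bigr => k _.
by rewrite mxE exprMn fpsCX coefs_CM !mulrA (mulrC (l i ^+ k)).
Qed.

End PowerSeries.

Section Exponential.
Variable K : numFieldType.
Implicit Types a b : K.

(** All scalar exponentials below have an exponent [a hh^2]; [qser] is the case [a = 1 / (24 h)]. *)
Definition expX2 a : fps K := fps_exp (fpsC a * fpsX K ^+ 2).

Lemma fps_expCM c a : fps_exp (fpsC c * (fpsC a * fpsX K ^+ 2)) = expX2 (c * a).
Proof. by rewrite /expX2 mulrA (rmorphM (@fpsC K)). Qed.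

Lemma coefs_expX2 a n :
  coefs (expX2 a) n = if odd n then 0 else a ^+ n./2 / (n./2)`!%:R.
Proof.
have termE k : coefs ((fpsC a * fpsX K ^+ 2) ^+ k) n = a ^+ k * (n == k.*2)%:R.
  by rewrite exprMn fpsCX coefs_CM -exprM mul2n coefs_Xn.
rewrite /expX2 [LHS]/=; under eq_bigr do rewrite termE; case: ifP => [n_odd|/negbT n_even].
  rewrite big1 // => k _; case: eqP => [nk|]; last by rewrite mulr0 mul0r.
  by rewrite nk odd_double in n_odd.
have n2 : n = n./2.*2 by rewrite even_halfK.
have lt_n2 : (n./2 < n.+1)%N by lia.
rewrite (bigD1 (Ordinal lt_n2)) //= -n2 eqxx mulr1 big1 ?addr0 // => k kn.
case: eqP => [nk|]; last by rewrite mulr0 mul0r.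
by case/eqP: kn; apply: val_inj; exact: etrans (esym (doubleK k)) (esym (congr1 half nk)).
Qed.

Lemma sum_even (F : nat -> K) m : (forall i, odd i -> F i = 0) ->
  \sum_(i < m.*2.+1) F i = \sum_(j < m.+1) F j.*2.
Proof.
move=> Fodd; elim: m => [|m IHm]; first by rewrite !big_ord1.
rewrite doubleS big_ord_recr big_ord_recr /= IHm [RHS]big_ord_recr /=.
by rewrite [F m.*2.+1]Fodd ?addr0 //= odd_double.
Qed.

(** In degree [2m] only even indices contribute to the convolution, and what remains is the binomial
    theorem. *)
Lemma expX2D a b : expX2 (a + b) = expX2 a * expX2 b.
Proof.
apply: fpsP => n; rewrite coefs_expX2.
rewrite -[RHS]/(\sum_(i < n.+1) coefs (expX2 a) i * coefs (expX2 b) (n - i)).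
under [RHS]eq_bigr do rewrite !coefs_expX2.
have [n_odd|n_even] := boolP (odd n).
  rewrite big1 // => i _; case: ifP => [|/negbT i_even]; first by rewrite mul0r.
  by rewrite oddB ?n_odd ?(negbTE i_even) ?mulr0 // -ltnS.
rewrite -(even_halfK n_even); move: n./2 => m {n n_even}; rewrite doubleK.
rewrite (sum_even (F := fun i => (if odd i then 0 else a ^+ i./2 / (i./2)`!%:R) *
   (if odd (m.*2 - i) then 0 else b ^+ (m.*2 - i)./2 / ((m.*2 - i)./2)`!%:R))); last first.
  by move=> i ->; rewrite mul0r.
rewrite exprDn mulr_suml [RHS](reindex_inj rev_ord_inj) /=.
apply: eq_bigr => j _; rewrite subSS -doubleB !odd_double !doubleK.
have jm : (j <= m)%N by rewrite -ltnS.
rewrite subKn // -(bin_fact jm) !natrM.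
have [c0 j0 mj0] : [/\ 'C(m, j)%:R != 0 :> K, j`!%:R != 0 :> K & (m - j)`!%:R != 0 :> K].
  by rewrite !pnatr_eq0 -!lt0n !fact_gt0 bin_gt0.
by rewrite -mulr_natr; field; rewrite c0 j0 mj0.
Qed.

Lemma expX20 : expX2 0 = 1.
Proof.
apply: fpsP => n; rewrite coefs_expX2; case: n => [|n] /=; first by rewrite divr1.
case: ifP => // /negbFE; case: n => // n _; rewrite /= expr0n mul0r //.
Qed.

Lemma expX2N a : expX2 (- a) = (expX2 a)^-1.
Proof.
have aN : expX2 (- a) * expX2 a = 1 by rewrite -expX2D addNr expX20.
have u : expX2 a \is a GRing.unit.
  by apply/unitrP; exists (expX2 (- a)); rewrite [expX2 a * _]mulrC aN.
by apply: (mulIr u); rewrite aN mulVr.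
Qed.

Lemma expX2Mn a n : expX2 (a *+ n) = expX2 a ^+ n.
Proof. by elim: n => [|n IHn]; rewrite ?expX20 // mulrS expX2D IHn exprS. Qed.

End Exponential.

(** * The skein relation *)

(** The cast is trivial: [7 ^ 1] and [7], as well as [7 ^ 2] and [7 * 7], are convertible. *)
Lemma mor_tens11 (K : comNzRingType) (A A' : 'M[K]_7) :
  mor_tens (A : mor K 1 1) (A' : mor K 1 1) = (A *t A' : 'M[K]_(7 * 7)).
Proof. exact: castmx_id. Qed.

Lemma mor_flip11 (K : comNzRingType) : mor_flip 1 1 = flip_mx K 7 :> 'M[K]_(7 * 7).
Proof. exact: castmx_id. Qed.

Lemma cast_mor_id (K : Type) a b (ea : a = a) (eb : b = b) (f : mor K a b) :
  cast_mor ea eb f = f.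
Proof. exact: castmx_id. Qed.

Section Rep.
Variables (K : fieldType) (g : vectType K) (br : g -> g -> g) (rho : g -> 'M[K]_7).

Lemma rho_tens1 x : rho_tens rho 1 x = rho x.
Proof.
rewrite /rho_tens /mor_tens tensmx0 castmx_const addr0 tens_mx_scalar scale1r castmx_comp.
exact: castmx_id.
Qed.

Lemma rho_tens2 x : rho_tens rho 2 x = coproduct (rho x).
Proof.
rewrite -[rho_tens rho 2 x]/(mor_tens (rho x : mor K 1 1) (mor_id 1) +
  mor_tens (mor_id 1) (rho_tens rho 1 x)) rho_tens1.
by rewrite mor_tens11 mor_tens11.
Qed.

End Rep.

Lemma casimir11 (C : numClosedFieldType) (g : vectType C) (br : g -> g -> g)
    (rho : g -> 'M[C]_7) h :
  casimir br rho h 1 1 = casimir_square br rho h.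
Proof.
apply: eq_bigr => i _; apply: eq_bigr => j _.
by rewrite !rho_tens1 mor_tens11.
Qed.

(** Here [p1, ..., p4] belong to the summands [C, V, L, W], and [A, B, D] stand for
    [q^-6, q^-3, q^-1]. On [p3] and [p4] the relation reads [-1 = -q + (q - 1)] and
    [q = 1 + (q - 1)]; the last two terms balance it on [p1] and [p2]. *)
Lemma skein_combination (R : comNzRingType) N (t p1 p2 p3 p4 : 'M[R]_N) (q A B D : R) :
  t *m p1 = p1 -> t *m p2 = - p2 -> t *m p3 = - p3 -> t *m p4 = p4 -> q * D = 1 ->
  t *m (A *: p1 + B *: p2 + 1 *: p3 + q *: p4) =
  q *: (t *m (q ^+ 6 *: p1 + q ^+ 3 *: p2 + 1 *: p3 + D *: p4))
  + (q - 1) *: (p1 + p2 + p3 + p4)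
  + (- q ^+ 7 + A - q + 1) *: p1 + (q ^+ 4 - B - q + 1) *: p2.
Proof.
move=> tp1 tp2 tp3 tp4 qD.
rewrite !mulmxDr -!scalemxAr tp1 tp2 tp3 tp4 !scalerDr (scalerA q D) qD.
by apply/matrixP => x y; rewrite !mxE; ring.
Qed.

(** * Spectral form of the crossings *)

Section SkeinMatrix.
Variables (K : numFieldType) (N : nat) (t PC PV : 'M[K]_N) (a : K).
Hypotheses (tt : t *m t = 1%:M) (tPC : t *m PC = PC) (PCt : PC *m t = PC).
Hypotheses (tPV : t *m PV = - PV) (PVt : PV *m t = - PV).
Hypotheses (PCPC : PC *m PC = PC) (PVPV : PV *m PV = PV).

(** Inserting the flip gives [PC PV = PC t PV = - PC PV]. *)
Let PCPV : PC *m PV = 0.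
Proof.
have E : PC *m PV = - (PC *m PV) by rewrite -{1}PCt -mulmxA tPV mulmxN.
apply/eqP; have : (2%:R : K) *: (PC *m PV) == 0 by rewrite scaler_nat mulr2n {1}E addNr.
by rewrite scaler_eq0 pnatr_eq0.
Qed.

Let PVPC : PV *m PC = 0.
Proof.
have E : PV *m PC = - (PV *m PC) by rewrite -{1}tPC mulmxA PVt mulNmx.
apply/eqP; have : (2%:R : K) *: (PV *m PC) == 0 by rewrite scaler_nat mulr2n {1}E addNr.
by rewrite scaler_eq0 pnatr_eq0.
Qed.

(** For [a = 1 / (24 h)] the product of [a hh^2] and [M] is [hh^2 Omega / 2]. [PL] and [PW] complete
    [PV] and [PC] to the projections on the exterior and the symmetric square, and [l] lists the
    eigenvalues of [M]. *)
Let M := 2%:R^-1 *: (1%:M + t - 14%:R *: PC - 6%:R *: PV).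
Let PL := 2%:R^-1 *: (1%:M - t) - PV.
Let PW := 2%:R^-1 *: (1%:M + t) - PC.
Let P (i : 'I_4) : 'M[K]_N := nth 0 [:: PC; PV; PL; PW] i.
Let l (i : 'I_4) : K := nth 0 [:: - 6%:R; - 3%:R; 0; 1] i.

Let sum4 (V : nmodType) (G : K -> 'M[K]_N -> V) : \sum_i G (l i) (P i) =
  G (- 6%:R) PC + G (- 3%:R) PV + G 0 PL + G 1 PW.
Proof. by rewrite !big_ord_recl big_ord0 addr0 !addrA. Qed.

Let sumP : \sum_i P i = 1%:M.
Proof.
by rewrite !big_ord_recl big_ord0 /P /=; apply/matrixP => i j; rewrite !mxE; field.
Qed.

Let MP i : M *m P i = l i *: P i.
Proof.
have MPC : M *m PC = - 6%:R *: PC.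
  rewrite -scalemxAl !mulmxBl mulmxDl mul1mx tPC -!scalemxAl PCPC PVPC.
  by apply/matrixP => x y; rewrite !mxE; field.
have MPV : M *m PV = - 3%:R *: PV.
  rewrite -scalemxAl !mulmxBl mulmxDl mul1mx tPV -!scalemxAl PCPV PVPV.
  by apply/matrixP => x y; rewrite !mxE; field.
have Mt : M *m t = 2%:R^-1 *: (t + 1%:M - 14%:R *: PC + 6%:R *: PV).
  rewrite -scalemxAl !mulmxBl mulmxDl mul1mx tt -!scalemxAl PCt PVt.
  by rewrite scalerN opprK.
case: i => -[|[|[|[|//]]]] lti; rewrite /P /l /=.
- exact: MPC.
- exact: MPV.
- rewrite mulmxBr -scalemxAr mulmxBr mulmx1 MPV Mt.
  by apply/matrixP => x y; rewrite !mxE; field.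
- rewrite mulmxBr -scalemxAr mulmxDr mulmx1 MPC Mt.
  by apply/matrixP => x y; rewrite !mxE; field.
Qed.

Lemma skein_matrix (f := fpsC a * fpsX K ^+ 2) (q := expX2 a) :
  fpsM t *m mx_exp (f *: fpsM M) =
  q *: (fpsM t *m mx_exp (- (f *: fpsM M))) + (q - 1) *: 1%:M
  + (- q ^+ 7 + q ^- 6 - q + 1) *: fpsM PC + (q ^+ 4 - q ^- 3 - q + 1) *: fpsM PV.
Proof.
(* The function [e] is the identity for the positive crossing and the opposite for the negative
   one. *)
have expE (e : K -> K) : \sum_i fps_exp (fpsC (e (l i)) * f) *: fpsM (P i) =
    expX2 (e (- 6%:R) * a) *: fpsM PC + expX2 (e (- 3%:R) * a) *: fpsM PV
    + expX2 (e 0 * a) *: fpsM PL + expX2 (e 1 * a) *: fpsM PW.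
  rewrite (sum4 (fun c S => fps_exp (fpsC (e c) * f) *: fpsM S)).
  by rewrite !fps_expCM.
have qu : q \is a GRing.unit.
  apply/unitrP; exists (expX2 (- a)).
  by rewrite /q -!expX2D addNr subrr expX20.
have -> : - (f *: fpsM M) = f *: fpsM (- M) by rewrite map_mxN scalerN.
rewrite (mx_exp_eigen _ sumP MP) (expE id).
rewrite (mx_exp_eigen (l := fun i => - l i) _ sumP); last first.
  by move=> i; rewrite mulNmx MP scaleNr.
rewrite (expE (fun x => - x)).
have tPL : t *m PL = - PL.
  rewrite mulmxBr -scalemxAr mulmxBr mulmx1 tt tPV.
  by apply/matrixP => x y; rewrite !mxE; ring.
have tPW : t *m PW = PW.
  rewrite mulmxBr -scalemxAr mulmxDr mulmx1 tt tPC addrC.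
  by apply/matrixP => x y; rewrite !mxE; ring.
have -> : 1%:M = fpsM PC + fpsM PV + fpsM PL + fpsM PW.
  rewrite -!map_mxD -(map_mx1 (@fpsC K)) -sumP; congr (map_mx _ _).
  by rewrite (sum4 (fun _ S => S)).
have q3 : expX2 (3%:R * a) = q ^+ 3 by rewrite mulr_natl expX2Mn.
have q6 : expX2 (6%:R * a) = q ^+ 6 by rewrite mulr_natl expX2Mn.
rewrite !opprK oppr0 mul0r !mulNr !expX2N !mul1r q3 q6 expX20 -/q.
have tE S : fpsM t *m fpsM S = fpsM (t *m S) by rewrite fpsM_mul.
apply: skein_combination; last exact: mulrV.
- by rewrite tE tPC.
- by rewrite tE tPV map_mxN.
- by rewrite tE tPL map_mxN.
- by rewrite tE tPW.
Qed.

End SkeinMatrix.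

Unset Implicit Arguments.

Theorem theorem4p4 (R : realType) (g : vectType R[i]) (br : g -> g -> g)
    (rho : g -> 'M[R[i]]_7) (h : R[i]) (D : inv_data R)
    (br_lie : is_lie_bracket br) (g_simple : lie_simple br)
    (g_G2 : lie_type_G2 br)
    (rho_rep : is_lie_rep br rho) (rho_irr : lie_irreducible rho)
    (h_neq0 : h != 0) (D_data : is_inv_data br rho h D) :
  let q : fps R[i] := qser h in
  let c : fps R[i] := cser D in
  let r : fps R[i] := rser D in
  let alpha : fps R[i] := q in
  let beta : fps R[i] := q - 1 in
  let gamma : fps R[i] := (7%:R * c)^-1 * (- q ^+ 7 + q ^- 6 - q + 1) in
  let delta : fps R[i] := r^-1 * (q ^+ 4 - q ^- 3 - q + 1) in
  let I (S : tangle (wprod wdiam wdiam) (wprod wdiam wdiam)) :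
      'M[fps R[i]]_(7 ^ 2) := tangle_inv br rho h D S in
  I tangle_Xpos = alpha *: I tangle_Xneg + beta *: I tangle_E
                  + gamma *: I tangle_U + delta *: I tangle_H.
Proof.
move=> q c r alpha beta gamma delta I.
have [[eqC eqV eqpC eqpV] [pCiC pViV] [multE k_neq0] [_ c_unit sqrtcE _]
  [_ x_unit y_unit _]] := D_data.
pose iC : 'M[R[i]]_(7 * 7, 1) := embC D; pose iV : 'M[R[i]]_(7 * 7, 7) := embV D.
pose pC : 'M[R[i]]_(1, 7 * 7) := projC D; pose pV : 'M[R[i]]_(7, 7 * 7) := projV D.
have [||||||casE [tiC pCt] [tiV pVt]] := @tensor_square_casimir _ g br rho h
  br_lie g_simple g_G2 rho_rep rho_irr h_neq0 iC pC iV pV.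
- by move=> x; rewrite -rho_tens2; have := eqC x; rewrite /mor_comp mulmx0.
- by move=> x; rewrite -rho_tens2; have := eqpC x; rewrite /mor_comp mul0mx => /esym.
- by move=> x; rewrite -rho_tens2; have := eqV x; rewrite /mor_comp rho_tens1.
- by move=> x; rewrite -rho_tens2; have := eqpV x; rewrite /mor_comp rho_tens1 => /esym.
- exact: pCiC.
- exact: pViV.
pose t := flip_mx R[i] 7; pose f := fpsC (24%:R * h)^-1 * fpsX R[i] ^+ 2.
pose M := 2%:R^-1 *: (1%:M + t - 14%:R *: (iC *m pC) - 6%:R *: (iV *m pV)).
(* [hh^2 Omega / 2 = f M], from [24 h Omega = 2 M] and [f = hh^2 / (24 h)]. *)
have TE : fpsC 2%:R^-1 *: T_op br rho h 1 1 = f *: fpsM M.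
  pose W : 'M[fps R[i]]_(7 * 7) := fpsM (casimir_square br rho h).
  have -> : T_op br rho h 1 1 = fpsX R[i] ^+ 2 *: W by rewrite /T_op casimir11.
  have -> : fpsM M = fpsC 2%:R^-1 *: (fpsC (24%:R * h) *: W).
    by rewrite /M -casE fpsMZ fpsMZ.
  have E : fpsC 2%:R^-1 = fpsC (24%:R * h)^-1 * fpsC 2%:R^-1 * fpsC (24%:R * h).
    by rewrite -!fpsCM; congr fpsC; field; rewrite h_neq0.
  have fE : fpsC 2%:R^-1 * fpsX R[i] ^+ 2 = f * fpsC 2%:R^-1 * fpsC (24%:R * h).
    by rewrite [in LHS]E /f; ring.
  by rewrite [LHS]scalerA fE [RHS]scalerA [RHS]scalerA.
have tE : flip_mx (fps R[i]) 7 = fpsM t.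
  by apply/matrixP => x y; rewrite !mxE fpsC_nat.
have XposE : I tangle_Xpos = fpsM t *m mx_exp (f *: fpsM M).
  by rewrite -tE -mor_flip11 -TE; exact: cast_mor_id.
have XnegE : I tangle_Xneg = fpsM t *m mx_exp (- (f *: fpsM M)).
  by rewrite -tE -mor_flip11 -TE; exact: cast_mor_id.
have EE : I tangle_E = 1%:M by [].
(* Cup and cap contribute [sqrt c] each and the cap a factor [7], which cancels the denominator of
   [gamma]. *)
have UE : I tangle_U = (7%:R * c) *: fpsM (iC *m pC).
  rewrite -[I _]/((Defs.sqrtc D *: fpsM iC) *m (Defs.sqrtc D *: fpsM (7%:R *: pC))).
  rewrite -scalemxAl -scalemxAr scalerA -expr2 sqrtcE fpsMZ -scalemxAr.
  by rewrite scalerA -fpsM_mul fpsC_nat; congr (_ *: _); rewrite mulrC.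
(* As [mult D] is [k pV], the coefficient is [k x y = r], which cancels the denominator of
   [delta]. *)
have HE : I tangle_H = r *: fpsM (iV *m pV).
  pose mu : 'M[R[i]]_(7, 7 * 7) := mult D.
  rewrite -[I _]/((yser D *: fpsM iV) *m (xser D *: fpsM mu)) /mu.
  rewrite multE fpsMZ -scalemxAl -!scalemxAr !scalerA -fpsM_mul.
  by congr (_ *: _); rewrite /r /rser; ring.
have cu : 7%:R * c \is a GRing.unit.
  rewrite unitrM c_unit andbT -fpsC_nat rmorph_unit //.
  by rewrite unitfE pnatr_eq0.
have ru : r \is a GRing.unit.
  by rewrite !unitrM x_unit y_unit !andbT (rmorph_unit (@fpsC _)) // unitfE.
have unitKZ (u v : fps R[i]) (W : 'M[fps R[i]]_(7 * 7)) :
    u \is a GRing.unit -> (u^-1 * v) *: (u *: W) = v *: W.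
  by move=> uu; rewrite scalerA mulrAC mulVr ?mul1r.
rewrite UE HE /gamma /delta (unitKZ _ _ _ cu) (unitKZ _ _ _ ru) XposE XnegE EE.
apply: (@skein_matrix _ _ t (iC *m pC) (iV *m pV) (24%:R * h)^-1).
- by apply: slice_inj => m; rewrite -[t *m t]mulmx1 -mulmxA !slice_flip trmxK.
- by rewrite mulmxA tiC.
- by rewrite -mulmxA pCt.
- by rewrite mulmxA tiV mulNmx.
- by rewrite -mulmxA pVt mulmxN.
- by rewrite mulmxA -(mulmxA iC) [pC *m iC]pCiC mulmx1.
- by rewrite mulmxA -(mulmxA iV) [pV *m iV]pViV mulmx1.
Qed.
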